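(* There is an absolute constant $C$ such that the following holds. Let $F$ be a finite field of odd characteristic, let $e$ be a nontrivial additive character of $F$, and let $P_6=\{(\xi,\xi\cdot\xi):\xi\in F^5\}\subset F^6$. Then for every $f:P_6\to\mathbb{C}$, $$\|(f\,d\sigma)^\vee\|_{L^{8/3}(F^6)}\le C\,\|f\|_{L^2(P_6,d\sigma)}.$$ (That is, $R^*(2\to\frac83)\lesssim 1$; the constant $C$ does not depend on $q=|F|$.)
   Context: Here $\xi\cdot\eta=\sum_i\xi_i\eta_i$ is the standard dot product (on $F^5$ and on $F^6$), and $q=|F|$. The paraboloid $P_6$, which has $q^5$ points, carries the normalized counting measure $d\sigma$ assigning mass $q^{-5}$ to each point, so $\|f\|_{L^2(P_6,d\sigma)}^2=q^{-5}\sum_{\xi\in P_6}|f(\xi)|^2$. The Fourier extension operator is $$(f\,d\sigma)^\vee(x)=q^{-5}\sum_{\xi\in P_6}f(\xi)\,e(x\cdot\xi),\qquad x\in F^6.$$ The space $F^6$ carries counting measure, so $\|g\|_{L^{8/3}(F^6)}^{8/3}=\sum_{x\in F^6}|g(x)|^{8/3}$. $R^*(2\to r)$ denotes the best constant in $\|(f\,d\sigma)^\vee\|_{L^r(F^6)}\le R^*(2\to r)\|f\|_{L^2(P_6,d\sigma)}$. *)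

(* Defs.v *)
From HB Require Import structures.
From mathcomp Require Import all_boot all_order all_algebra.
From mathcomp Require Import complex reals exp.

Set Implicit Arguments.
Unset Strict Implicit.
Unset Printing Implicit Defensive.

Import Order.TTheory GRing.Theory Num.Theory.
Local Open Scope ring_scope.

Definition dotp (F : finFieldType) (m : nat) (x y : 'rV[F]_m) : F :=
  \sum_(i < m) x 0 i * y 0 i.

(* A homomorphism from (F, +) to the unit circle. *)
Definition additive_character (R : realType) (F : finFieldType)
    (e : F -> R[i]) : Prop :=
  (forall x, ComplexField.Normc.normc (e x) = 1) /\
  (forall x y, e (x + y) = e x * e y).

Definition nontrivial (R : realType) (F : finFieldType) (e : F -> R[i]) : Prop :=
  exists x, e x != 1.

(* The paraboloid P_(n+1) in F^(n+1); it has #|F| ^ n points. *)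
Definition paraboloid (F : finFieldType) (n : nat) : {set 'rV[F]_(n + 1)} :=
  [set row_mx xi (dotp xi xi)%:M | xi : 'rV[F]_n].

Definition on_paraboloid (F : finFieldType) (n : nat) : finType :=
  {xi : 'rV[F]_(n + 1) | xi \in paraboloid F n}.

(* The L^p norm of g for the measure giving mass w to each point of T. *)
Definition Lp_norm (R : realType) (T : finType) (w p : R) (g : T -> R[i]) : R :=
  (w * \sum_(x : T) (ComplexField.Normc.normc (g x)) `^ p) `^ p^-1.

(* The mass of a point of P_(n+1) for d sigma. *)
Definition sigma_mass (R : realType) (F : finFieldType) (n : nat) : R :=
  (#|F|%:R ^+ n)^-1.

(* The Fourier extension (f d sigma)^\vee. *)
Definition extension (R : realType) (F : finFieldType) (n : nat) (e : F -> R[i])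
    (f : on_paraboloid F n -> R[i]) (x : 'rV[F]_(n + 1)) : R[i] :=
  real_complex R (sigma_mass R F n) *
  \sum_(xi : on_paraboloid F n) f xi * e (dotp x (val xi)).

(* Main.v *)
(** By duality it is enough to show that, if [sum |g|^(8/5) <= 1] on [F^6], then
    the restriction of the Fourier transform of [g] to [P_6] is bounded in
    [L^2(d sigma)].  The part of [g] below [q^(-5/2)] is handled by Plancherel.  The
    rest is cut into dyadic level sets, all of size at most [q^4], and on these the
    form [(g, h) |-> <g, h * ((d sigma)^\vee - delta)>] is bounded by
    [min(|E|^(3/4) |G|^(1/2), |E|^(1/2) |G|^(3/4))] for [|g| <= 1_E], [|h| <= 1_G];
    using both bounds gives geometric decay off the diagonal, so no logarithm is lost.

    The form is estimated by slicing [h] horizontally: completing the square turns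
    the extension of a slice into the Fourier extension of a function on the
    paraboloid, whose fourth moment is an additive energy.  The energy of
    [E] in [F^5] counts rectangles [a, a + x, a + y, a + x + y], and it is at most a
    constant times [N^3 / q + q^2 N^2], [N = |E|].  Indeed, call a line rich if it
    has at least [N / q^2] points of [E].  Rectangles with a side on a poor line are
    controlled by the second moment of the point-hyperplane incidences; those with a
    side on a rich line of non-isotropic direction are counted by an injection; and
    those with two isotropic sides by the orthogonality graph of the isotropic cone,
    where the oddness of the dimension 5 matters. *)

Require Import Defs.
From HB Require Import structures.
From mathcomp Require Import all_boot all_order all_algebra.
From mathcomp Require Import ring lra.
From mathcomp Require Import complex reals exp.

Set Implicit Arguments.
Unset Strict Implicit.
Unset Printing Implicit Defensive.

Import Order.TTheory GRing.Theory Num.Theory.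
Import ComplexField.Normc.
Local Open Scope ring_scope.


(** * Cardinalities written as sums *)

Section Cardinals.

Lemma card_indicator (T : finType) (P : pred T) (A : pzSemiRingType) :
  #|[set b | P b]|%:R = \sum_b (P b)%:R :> A.
Proof.
rewrite -sum1_card natr_sum big_mkcond; apply: eq_bigr => b _.
by rewrite inE; case: (P b).
Qed.

Lemma card_dep_pairs (T U : finType) (A : {set T}) (P : T -> U -> bool) :
  #|[set p : T * U | (p.1 \in A) && P p.1 p.2]| = (\sum_(t in A) #|[set u | P t u]|)%N.
Proof.
rewrite -sum1_card; under [RHS]eq_bigr do rewrite -sum1_card.
rewrite pair_big_dep /=; apply: eq_bigl => -[t u]; by rewrite !inE.
Qed.

Lemma card_field_gt0 {F : finFieldType} : (0 < #|F|)%N.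
Proof. by apply/card_gt0P; exists 0. Qed.

End Cardinals.

(** * Characters and Gauss sums *)

Section DotProduct.
Variables (F : finFieldType) (m : nat).
Implicit Types x y z : 'rV[F]_m.

Lemma dotpC x y : dotp x y = dotp y x.
Proof. by apply: eq_bigr => i _; rewrite mulrC. Qed.

Lemma dotpDl x y z : dotp (x + y) z = dotp x z + dotp y z.
Proof. by rewrite -big_split; apply: eq_bigr => i _; rewrite mxE mulrDl. Qed.

Lemma dotpDr x y z : dotp x (y + z) = dotp x y + dotp x z.
Proof. by rewrite dotpC dotpDl !(dotpC x). Qed.

Lemma dotpZl a x y : dotp (a *: x) y = a * dotp x y.
Proof. by rewrite mulr_sumr; apply: eq_bigr => i _; rewrite mxE mulrA. Qed.

Lemma dotpZr a x y : dotp x (a *: y) = a * dotp x y.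
Proof. by rewrite dotpC dotpZl dotpC. Qed.

Lemma dotpNl x y : dotp (- x) y = - dotp x y.
Proof. by rewrite -scaleN1r dotpZl mulN1r. Qed.

Lemma dotpNr x y : dotp x (- y) = - dotp x y.
Proof. by rewrite dotpC dotpNl dotpC. Qed.

Lemma dotpBl x y z : dotp (x - y) z = dotp x z - dotp y z.
Proof. by rewrite dotpDl dotpNl. Qed.

Lemma dotpBr x y z : dotp x (y - z) = dotp x y - dotp x z.
Proof. by rewrite dotpDr dotpNr. Qed.

Lemma dotp0l x : dotp 0 x = 0.
Proof. by rewrite -(scale0r 0) dotpZl mul0r. Qed.

Lemma dotp0r x : dotp x 0 = 0.
Proof. by rewrite dotpC dotp0l. Qed.

Lemma dotp_nondegenerate x : x != 0 -> exists y, dotp x y = 1.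
Proof.
case/rV0Pn => i xi; exists ((x 0 i)^-1 *: delta_mx 0 i).
rewrite dotpZr /dotp (bigD1 i) //= big1 ?mxE ?eqxx ?addr0 ?mulr1 ?mulVf //.
by move=> j ji; rewrite mxE (negPf ji) andbF mulr0.
Qed.

End DotProduct.

Definition dotpE := (dotpDl, dotpDr, dotpBl, dotpBr, dotpNl, dotpNr, dotpZl, dotpZr).

Section ComplexNorm.
Variable R : realType.
Implicit Types z : R[i].

Lemma normc_sqr z : real_complex R (normc z ^+ 2) = z * conjc z.
Proof. by rewrite rmorphXn /= -sqr_normc; case: z. Qed.

Lemma normc_ge0 z : 0 <= normc z.
Proof. by case: z => a b; apply: sqrtr_ge0. Qed.

Lemma normc_conj z : normc (conjc z) = normc z.
Proof. by case: z => a b /=; rewrite sqrrN. Qed.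

Lemma normc_real (r : R) : normc (real_complex R r) = `|r|.
Proof. by rewrite /= expr0n /= addr0 sqrtr_sqr. Qed.

Lemma normc_sum (I : finType) (P : pred I) (G : I -> R[i]) :
  normc (\sum_(i | P i) G i) <= \sum_(i | P i) normc (G i).
Proof.
elim/big_ind2: _ => [|x1 x2 y1 y2 h1 h2|//]; first by rewrite normc0.
exact: le_trans (le_normcD _ _) (lerD h1 h2).
Qed.

Lemma normcX z n : normc (z ^+ n) = normc z ^+ n.
Proof. by elim: n => [|n IH]; rewrite ?expr0 ?normc1 // !exprS normcM IH. Qed.

End ComplexNorm.

Section Character.
Variables (R : realType) (F : finFieldType) (e : F -> R[i]).
Hypotheses (eP : additive_character e) (e_nontriv : nontrivial e).
Local Notation q := (#|F|%:R : R[i]).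

Lemma charD x y : e (x + y) = e x * e y. Proof. exact: eP.2. Qed.

Lemma char0 : e 0 = 1.
Proof.
have n0 : e 0 != 0.
  by apply/eqP => h; move: (eP.1 0); rewrite h normc0 => /eqP; rewrite eq_sym oner_eq0.
by apply: (mulfI n0); rewrite -charD addr0 mulr1.
Qed.

Lemma char_conj x : conjc (e x) = e (- x).
Proof.
have h : e x * conjc (e x) = 1 by rewrite -normc_sqr eP.1 expr1n.
have n0 : e x != 0 by apply/eqP => h0; move/eqP: h; rewrite h0 mul0r eq_sym oner_eq0.
by apply: (mulfI n0); rewrite h -charD subrr char0.
Qed.

(** Translating by a [w] with [phi w = a], where [e a != 1], multiplies the sum by [e a], so it
    vanishes. The last two hypotheses provide such a [w]. *)
Lemma sum_char_eq0 (V : finZmodType) (phi : V -> F) :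
  {morph phi : x y / x + y} -> (exists v, phi v = 1) ->
  (forall (v : V) (a : F), exists w, phi w = a * phi v) ->
  \sum_v e (phi v) = 0.
Proof.
move=> phiD [v1 h1] phiZ; case: e_nontriv => a ea.
have [w hw] := phiZ v1 a; rewrite h1 mulr1 in hw.
suff /eqP : (e a - 1) * \sum_v e (phi v) = 0.
  by rewrite mulf_eq0 subr_eq0 (negPf ea) => /eqP.
rewrite mulrBl mul1r [X in _ - X](reindex_inj (addrI w)) /= mulr_sumr -sumrB.
by apply: big1 => v _; rewrite phiD hw charD subrr.
Qed.

Lemma sum_char (z : F) : \sum_(s : F) e (s * z) = q * (z == 0)%:R.
Proof.
have [->|z0] := eqVneq z 0.
  under eq_bigr do rewrite mulr0 char0.
  by rewrite sumr_const mulr1.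
rewrite mulr0; apply: sum_char_eq0 => [x y||v a]; first by rewrite mulrDl.
- by exists z^-1; rewrite mulVf.
- by exists (a * v); rewrite mulrA.
Qed.

Lemma sum_char_dotp m (u : 'rV[F]_m) :
  \sum_(x : 'rV[F]_m) e (dotp x u) = q ^+ m * (u == 0)%:R.
Proof.
have [->|u0] := eqVneq u 0.
  under eq_bigr do rewrite dotp0r char0.
  by rewrite sumr_const mulr1 -natrX card_mx mul1n.
rewrite mulr0; apply: sum_char_eq0 => [x y||v a]; first by rewrite dotpDl.
- by have [y hy] := dotp_nondegenerate u0; exists y; rewrite dotpC.
- by exists (a *: v); rewrite dotpZl.
Qed.

End Character.

Section Gauss.
Variables (R : realType) (F : finFieldType) (e : F -> R[i]).
Hypotheses (eP : additive_character e) (e_nontriv : nontrivial e).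
Local Notation q := (#|F|%:R : R[i]).

Lemma indicator_char (z : F) : q * (z == 0)%:R = \sum_(s : F) e (s * z).
Proof. by rewrite (sum_char eP e_nontriv). Qed.

(** Expanding the square leaves the pairs selected by orthogonality. With [r] equality this is
    Plancherel; with [r] an additive relation between pairs it turns a fourth moment into an
    energy. *)
Lemma orthogonal_moment (W I : finType) (psi : I -> W -> R[i]) (c : I -> R[i])
    (K : R[i]) (r : rel I) :
  (forall i j, \sum_w psi i w * conjc (psi j w) = K * (r i j)%:R) ->
  \sum_w (\sum_i c i * psi i w) * conjc (\sum_i c i * psi i w) =
    K * \sum_i \sum_(j | r i j) c i * conjc (c j).
Proof.
move=> h; under eq_bigr => w _.
  rewrite rmorph_sum /= big_distrlr /=.
  over.
rewrite exchange_big mulr_sumr; apply: eq_bigr => i _ /=.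
rewrite exchange_big mulr_sumr big_mkcond [RHS]big_mkcond /=; apply: eq_bigr => j _.
transitivity (c i * conjc (c j) * (K * (r i j)%:R)); last first.
  by case: (r i j); rewrite ?mulr1 ?mulr0 // mulrC.
by rewrite -h mulr_sumr; apply: eq_bigr => w _; rewrite rmorphM /= mulrACA.
Qed.

Lemma char_dotp_orthogonal m (u v : 'rV[F]_m) :
  \sum_(w : 'rV[F]_m) e (dotp w u) * conjc (e (dotp w v)) = q ^+ m * (u == v)%:R.
Proof.
rewrite -subr_eq0 -(sum_char_dotp eP e_nontriv); apply: eq_bigr => w _.
by rewrite (char_conj eP) -(charD eP) dotpBr.
Qed.

Hypothesis F2 : 2%N \notin [pchar F].

Lemma two_neq0 : 2%:R != 0 :> F.
Proof. by apply: contra F2 => h; rewrite inE h. Qed.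

Lemma four_neq0 : 4%:R != 0 :> F.
Proof. by rewrite (natrM _ 2 2) mulf_neq0 // two_neq0. Qed.

Definition gauss n (r : F) : R[i] := \sum_(b : 'rV[F]_n) e (r * dotp b b).

(** Completing the square: translating [b] by [- u / (2 r)] removes the linear term. *)
Lemma gauss_shift n r (u : 'rV[F]_n) : r != 0 ->
  \sum_(b : 'rV[F]_n) e (r * dotp b b + dotp b u) =
    gauss n r * e (- (dotp u u / (4%:R * r))).
Proof.
move=> r0; rewrite (reindex_inj (addIr (- (2%:R * r)^-1 *: u))) mulr_suml /=.
apply: eq_bigr => b _; rewrite -(charD eP); congr e; rewrite !dotpE (dotpC u b).
by field; rewrite r0 four_neq0 two_neq0.
Qed.

(** Plancherel for the function [e (r * dotp b b)] of [b]: it has modulus 1, and by [gauss_shift]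
    all its Fourier coefficients have the modulus of [gauss n r]. *)
Lemma gauss_norm n r : r != 0 -> gauss n r * conjc (gauss n r) = q ^+ n.
Proof.
move=> r0.
have := @orthogonal_moment _ _ _ (fun b => e (r * dotp b b)) _ _
  (@char_dotp_orthogonal n).
under eq_bigr => u _.
  under eq_bigr => b _ do rewrite -(charD eP) (dotpC u).
  rewrite gauss_shift // rmorphM /= mulrACA -(normc_sqr (e _)) eP.1 expr1n mulr1.
  over.
under [X in _ = _ * X -> _]eq_bigr => b _.
  rewrite (eq_bigl (pred1 b)) => [|b']; last by rewrite /= eq_sym.
  rewrite big_pred1_eq -(normc_sqr (e _)) eP.1 expr1n /=.
  over.
rewrite !sumr_const card_mx mul1n -[X in X = _ -> _]mulr_natl natrX => h.
have q0 : q ^+ n != 0 by rewrite expf_neq0 // pnatr_eq0 -lt0n card_field_gt0.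
by apply: (mulfI q0); rewrite h.
Qed.

Definition gauss1 (r : F) : R[i] := \sum_(x : F) e (r * x ^+ 2).

Lemma gauss_prod n r : gauss n r = gauss1 r ^+ n.
Proof.
rewrite -[in RHS](card_ord n) -prodr_const bigA_distr_bigA /gauss.
rewrite (reindex (fun f : {ffun 'I_n -> F} => \row_i f i)) /=; last first.
  exists (fun b : 'rV[F]_n => [ffun i => b 0 i]) => b _.
    by apply/ffunP => i; rewrite ffunE mxE.
  by apply/rowP => i; rewrite mxE ffunE.
apply: eq_bigr => f _; rewrite /dotp mulr_sumr.
rewrite (big_morph e (charD eP) (char0 eP)).
by apply: eq_bigr => i _; rewrite mxE expr2.
Qed.

Let gauss1 (r : F) := \sum_(x : F) e (r * x ^+ 2).

Lemma gauss1_norm r : r != 0 -> gauss1 r * conjc (gauss1 r) = q.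
Proof. by move=> r0; rewrite -[q]expr1 -(@gauss_norm 1 r) // gauss_prod expr1. Qed.

Lemma gauss1_opp r : gauss1 (- r) = conjc (gauss1 r).
Proof.
by rewrite rmorph_sum /=; apply: eq_bigr => x _; rewrite (char_conj eP) mulNr.
Qed.

Lemma gauss1_sqr r : gauss1 r ^+ 2 = \sum_(p : F * F) e (r * (p.1 ^+ 2 + p.2 ^+ 2)).
Proof.
rewrite expr2 big_distrlr pair_big /=.
by apply: eq_bigr => p _; rewrite -(charD eP) mulrDr.
Qed.

Lemma normc_card (n : nat) : normc (n%:R : R[i]) = n%:R.
Proof. by rewrite -(rmorph_nat (real_complex R)) normc_real ger0_norm. Qed.

Lemma normc_gauss1_sqr s : s != 0 -> normc (gauss1 s) ^+ 2 = #|F|%:R.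
Proof.
move=> s0; apply: (@complexI R); rewrite normc_sqr gauss1_norm //.
by rewrite -(rmorph_nat (real_complex R)).
Qed.

(* Otherwise counting solutions with characters expresses [q ^ 2] as a sum of
   [q - 1] terms of modulus [q]. *)
Lemma opp1_sum_two_squares : exists a b : F, a ^+ 2 + b ^+ 2 = -1.
Proof.
have [/existsP[p /eqP hp]|/existsPn hn] :=
  boolP [exists p : F * F, p.1 ^+ 2 + p.2 ^+ 2 == -1].
  by exists p.1, p.2.
have : \sum_(p : F * F) \sum_(s : F) e (s * (p.1 ^+ 2 + p.2 ^+ 2 + 1)) = 0.
  apply: big1 => p _; rewrite -indicator_char addr_eq0.
  by rewrite (negPf (hn p)) mulr0.
rewrite exchange_big (bigD1 0) //=.
under eq_bigr do rewrite mul0r (char0 eP).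
rewrite sumr_const card_prod => /eqP; rewrite addr_eq0 => /eqP /(congr1 (@normc R)).
rewrite normc_card normcN => h.
have : (#|F| * #|F|)%:R <= \sum_(s : F | s != 0) #|F|%:R :> R.
  rewrite h; apply: le_trans (normc_sum _ _) _; apply: ler_sum => s s0.
  under eq_bigr do rewrite mulrDr (charD eP) mulr1.
  by rewrite -mulr_suml -gauss1_sqr normcM eP.1 mulr1 normcX normc_gauss1_sqr.
rewrite sumr_const -[X in _ <= X]mulr_natr -natrM ler_nat cardC1.
have := @card_field_gt0 F.
by case: #|F| => // k _; rewrite leq_mul2l ltnn.
Qed.

(** If [a ^+ 2 + b ^+ 2 = -1], the matrix with rows [(a, -b)] and [(b, a)] permutes the plane and
    negates the form [x ^+ 2 + y ^+ 2]. *)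
Lemma gauss1_sqr_opp r : gauss1 (- r) ^+ 2 = gauss1 r ^+ 2.
Proof.
have [a [b /(canRL (addrK _)) hab]] := opp1_sum_two_squares; rewrite !gauss1_sqr.
have inj : injective (fun p : F * F => (a * p.1 - b * p.2, b * p.1 + a * p.2)).
  apply: (@can_inj _ _ _ (fun p => (- (a * p.1 + b * p.2), b * p.1 - a * p.2))).
  by move=> [x y] /=; congr pair; ring: hab.
rewrite [RHS](reindex_inj inj); apply: eq_bigr => -[x y] _ /=; congr e.
by ring: hab.
Qed.

Lemma gauss1_pow4 r : r != 0 -> gauss1 r ^+ 4 = q ^+ 2.
Proof.
by move=> r0; rewrite (exprM _ 2 2) expr2 -{2}gauss1_sqr_opp -exprMn gauss1_opp gauss1_norm.
Qed.

(* This is where the parity of the dimension enters: the fourth power of the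
   one-dimensional sum does not depend on [r], so the fifth power has mean zero. *)
Lemma sum_gauss5 : \sum_(r : F | r != 0) gauss 5 r = 0.
Proof.
under eq_bigr => r r0 do rewrite gauss_prod exprS gauss1_pow4 //.
rewrite -mulr_suml; suff -> : \sum_(r | r != 0) gauss1 r = 0 by rewrite mul0r.
(* In the sum over all [r] only [x = 0] contributes, giving [q]. The term [r = 0] alone is already
   [q], so the remaining terms cancel. *)
have : \sum_r gauss1 r = q.
  rewrite exchange_big /= (bigD1 0) //= -indicator_char expr0n eqxx mulr1 big1 ?addr0 //.
  by move=> x x0; rewrite -indicator_char expf_eq0 (negPf x0) mulr0.
have g0 : gauss1 0 = q by under [LHS]eq_bigr do rewrite mul0r (char0 eP); rewrite sumr_const.
by rewrite (bigD1 0) //= g0 => /(canRL (addKr _)) ->; rewrite addNr.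
Qed.

End Gauss.

(** * Point counts on hyperplanes and on the isotropic cone *)

Section Counting.
Variables (R : realType) (F : finFieldType) (e : F -> R[i]).
Hypotheses (eP : additive_character e) (e_nontriv : nontrivial e).
Local Notation q := (#|F|%:R : R[i]).

(** When the equation is expanded in characters, only the zero frequency survives. The factor [#|F|]
    on the left avoids an exponent [n - 1]. *)
Lemma card_hyperplane n (x : 'rV[F]_n) t : x != 0 ->
  (#|F| * #|[set b | dotp b x == t]| = #|F| ^ n)%N.
Proof.
move=> x0; apply/eqP; rewrite -(eqr_nat R[i]) natrM natrX card_indicator mulr_sumr.
under eq_bigr => b _.
  rewrite -subr_eq0 (indicator_char eP e_nontriv).
  under eq_bigr => s _ do rewrite mulrBr (charD eP) -dotpZr mulrC.
  over.
rewrite exchange_big /=; under eq_bigr => s _.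
  rewrite -mulr_sumr (sum_char_dotp eP e_nontriv) scaler_eq0 (negPf x0) orbF.
  over.
rewrite (bigD1 0) //= big1 => [|s s0]; last by rewrite (negPf s0) !mulr0.
by rewrite mul0r oppr0 (char0 eP) eqxx mul1r mulr1 addr0.
Qed.

Lemma card_hyperplaneI n (x y : 'rV[F]_n) t u :
  (forall a b, a *: x + b *: y = 0 -> (a = 0) /\ (b = 0)) ->
  (#|F| ^ 2 * #|[set b | (dotp b x == t) && (dotp b y == u)]| = #|F| ^ n)%N.
Proof.
move=> free; apply/eqP; rewrite -(eqr_nat R[i]) natrM !natrX card_indicator mulr_sumr.
under eq_bigr => b _.
  rewrite -mulnb natrM expr2 mulrACA -(subr_eq0 (dotp b x)) -(subr_eq0 (dotp b y)).
  rewrite !(indicator_char eP e_nontriv) big_distrlr pair_big /=.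
  under eq_bigr => p _.
    rewrite -(charD eP) (_ : _ + _ = - (p.1 * t + p.2 * u) + dotp b (p.1 *: x + p.2 *: y));
      last by rewrite !dotpE; ring.
    rewrite (charD eP).
    over.
  over.
rewrite exchange_big /=; under eq_bigr => p _.
  rewrite -mulr_sumr (sum_char_dotp eP e_nontriv).
  over.
rewrite (bigD1 (0, 0)) //= big1 => [|[a b] p0] /=.
  by rewrite !(mul0r, addr0, oppr0, scale0r, char0 eP, eqxx, mul1r, mulr1).
case: eqP => [/free[a0 b0]|]; last by rewrite !mulr0.
by rewrite a0 b0 eqxx in p0.
Qed.

Hypothesis F2 : 2%N \notin [pchar F].

(** All three conditions are expanded in characters. The frequency [r = 0] of [dotp b b] yields the
    right-hand side, where [p] runs over the relations between [y] and [z]; the frequencies [r != 0]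
    cancel by [sum_gauss5]. *)
Lemma card_isotropicI (y z : 'rV[F]_5) : dotp y y = 0 -> dotp z z = 0 ->
  (#|F| ^ 3 * #|[set b | [&& dotp b b == 0%R, dotp b y == 0%R & dotp b z == 0%R]]|
   = #|F| ^ 5 * #|[set p : F * F | (p.1 *: y + p.2 *: z == 0)%R]|)%N.
Proof.
move=> yy zz; apply/eqP; rewrite -(eqr_nat R[i]) [X in X == _]natrM [X in _ == X]natrM.
rewrite !natrX !card_indicator mulr_sumr.
apply/eqP; pose u p := p.1 *: y + p.2 *: z.
transitivity (\sum_p \sum_r \sum_b e (r * dotp b b + dotp b (u p))).
  rewrite exchange_big; under [RHS]eq_bigr do rewrite exchange_big.
  rewrite [RHS]exchange_big; apply: eq_bigr => b _ /=.
  rewrite -!mulnb !natrM exprS expr2 mulrACA [q * q * _]mulrACA.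
  rewrite !(indicator_char eP e_nontriv) [X in _ * X]big_distrlr pair_big /=.
  rewrite big_distrlr /=; apply: eq_bigr => r _; apply: eq_bigr => p _.
  by rewrite -!(charD eP) -!dotpZr -dotpDr.
have uu p : dotp (u p) (u p) = 2%:R * p.1 * p.2 * dotp y z.
  by rewrite /u !dotpE yy zz (dotpC z y); ring.
under eq_bigr => p _.
  rewrite (bigD1 0) //=.
  under eq_bigr do rewrite mul0r add0r.
  rewrite (sum_char_dotp eP e_nontriv).
  under [X in _ + X]eq_bigr => r r0 do rewrite gauss_shift // uu.
  over.
rewrite big_split -mulr_sumr exchange_big /=.
(* Replacing [p.1] by [r * p.1] removes [r] from the phase, because [dotp (u p) (u p)] is a multiple
   of [p.1 * p.2]. Only [gauss 5 r] still depends on [r]. *)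
under [X in _ + X]eq_bigr => r r0.
  rewrite -mulr_sumr (reindex_inj (_ : injective (fun p : F * F => (r * p.1, p.2)))) /=;
    last by move=> [a b] [c d] /= [/(mulfI r0) -> ->].
  under eq_bigr => p _.
    rewrite (_ : _ / _ = 2%:R * p.1 * p.2 * dotp y z / 4%:R);
      last by field; rewrite r0 four_neq0.
    over.
  over.
by rewrite -mulr_suml (sum_gauss5 eP e_nontriv F2) mul0r addr0.
Qed.
End Counting.

(** * Additive energy on the paraboloid *)

Section Variance.
Variable R : realType.

(** Lagrange's identity writes twice the deficit as a double sum of squares. *)
Lemma cauchy_schwarz (I : finType) (P : pred I) (f g : I -> R) :
  (\sum_(i | P i) f i * g i) ^+ 2 <=
    (\sum_(i | P i) f i ^+ 2) * (\sum_(i | P i) g i ^+ 2).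
Proof.
have : 0 <= \sum_(i | P i) \sum_(j | P j) (f i * g j - f j * g i) ^+ 2.
  by do 2!apply: sumr_ge0 => ? _; apply: sqr_ge0.
have -> : \sum_(i | P i) \sum_(j | P j) (f i * g j - f j * g i) ^+ 2 =
    ((\sum_(i | P i) f i ^+ 2) * (\sum_(i | P i) g i ^+ 2) -
     (\sum_(i | P i) f i * g i) ^+ 2) *+ 2.
  rewrite mulrnBl mulr2n {2}(mulrC (\sum_(i | P i) f i ^+ 2)) expr2 !big_distrlr /=.
  rewrite -big_split -sumrMnl -sumrB; apply: eq_bigr => i _.
  rewrite -big_split -sumrMnl -sumrB; apply: eq_bigr => j _ /=.
  ring.
by rewrite pmulrn_lge0 // subr_ge0.
Qed.

Lemma sqr_sum_le (I : finType) (A : {set I}) (f : I -> R) :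
  (\sum_(i in A) f i) ^+ 2 <= #|A|%:R * \sum_(i in A) f i ^+ 2.
Proof.
have := cauchy_schwarz (mem A) (fun _ => 1) f.
under eq_bigr do rewrite mul1r.
by under [X in X * _]eq_bigr do rewrite expr1n; rewrite sumr_const.
Qed.

(** Second moment method: Cauchy-Schwarz over [E], then the variance over the larger set [D]. Each
    event [h i] has density [1 / Q] in [D], and pairs exceed the independent count by at most [K],
    and only when related by [r]. It serves for hyperplanes in the whole space and in the isotropic
    cone. *)
Lemma incidence_variance (T I : finType) (D E : {set T}) (S : {set I})
    (h : I -> T -> bool) (r : rel I) (Q K : R) :
  0 < Q -> E \subset D ->
  (forall i, i \in S -> Q * #|[set b in D | h i b]|%:R = #|D|%:R) ->
  (forall i j, i \in S -> j \in S ->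
    #|[set b in D | h i b && h j b]|%:R <= #|D|%:R / Q ^+ 2 + K * (r i j)%:R) ->
  (\sum_(b in E) \sum_(i in S) (h i b)%:R - #|S|%:R * #|E|%:R / Q) ^+ 2 <=
    #|E|%:R * (K * \sum_(i in S) \sum_(j in S) (r i j)%:R).
Proof.
move=> Q0 ED mean cov; set c := fun b => \sum_(i in S) (h i b)%:R : R.
have sumD (P : pred T) : \sum_(b in D) (P b)%:R = #|[set b in D | P b]|%:R :> R.
  rewrite -sum1_card natr_sum big_mkcond [RHS]big_mkcond; apply: eq_bigr => b _.
  by rewrite inE; case: (b \in D); case: (P b).
set m : R := #|S|%:R / Q.
have -> : \sum_(b in E) c b - #|S|%:R * #|E|%:R / Q = \sum_(b in E) (c b - m).
  by rewrite sumrB sumr_const -[X in _ = _ - X]mulr_natr mulrAC.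
apply: le_trans (sqr_sum_le _ _) _; apply: ler_wpM2l => //.
apply: (@le_trans _ _ (\sum_(b in D) (c b - m) ^+ 2)).
  rewrite [leRHS](big_setID E) /= (setIidPr ED) lerDl.
  by apply: sumr_ge0 => b _; apply: sqr_ge0.
have c1 : \sum_(b in D) c b = m * #|D|%:R.
  rewrite exchange_big /=.
  under eq_bigr => i iS.
    rewrite sumD; rewrite (_ : _%:R = #|D|%:R / Q);
      last by rewrite -(mean i iS) mulrAC divff ?mul1r ?gt_eqF.
    over.
  by rewrite sumr_const -[LHS]mulr_natr /m; ring.
have c2 : \sum_(b in D) c b ^+ 2 <= m ^+ 2 * #|D|%:R +
    K * \sum_(i in S) \sum_(j in S) (r i j)%:R.
  under eq_bigr do rewrite expr2 big_distrlr /=.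
  rewrite exchange_big /=; under eq_bigr do rewrite exchange_big /=.
  have -> : m ^+ 2 * #|D|%:R = \sum_(i in S) \sum_(j in S) #|D|%:R / Q ^+ 2.
    rewrite !sumr_const -[RHS]mulr_natr -[X in _ = X * _]mulr_natr /m.
    by field; rewrite gt_eqF.
  rewrite mulr_sumr -big_split; apply: ler_sum => i iS /=.
  rewrite mulr_sumr -big_split; apply: ler_sum => j jS /=.
  apply: le_trans (cov i j iS jS); under eq_bigr do rewrite -natrM mulnb.
  by rewrite sumD.
under eq_bigr do rewrite sqrrB.
rewrite big_split sumrB /= sumr_const -[X in _ + X]mulr_natr.
have -> : \sum_(b in D) c b * m *+ 2 = 2%:R * m * (m * #|D|%:R).
  by rewrite -c1 mulr_sumr; apply: eq_bigr => b _; rewrite -mulr_natl; ring.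
by move: c2; set u := \sum_(b in D) _; set v := K * _; lra.
Qed.

(** If [A > 2 m + c], then [(A - m)^2 > (m + c) (A - m) = c A + m (A - m - c) >= c A]. *)
Lemma le_of_sqr_le (A m c : R) : 0 <= m -> 0 <= c ->
  (A - m) ^+ 2 <= c * A -> A <= 2%:R * m + c.
Proof.
move=> m0 c0 h; rewrite leNgt; apply/negP => lt.
have : 0 < (A - m - (m + c)) * (A - m) by apply: mulr_gt0; lra.
have : 0 <= m * (A - m - c) by apply: mulr_ge0; lra.
have := mulr_ge0 m0 m0; nra.
Qed.

End Variance.

(** * Rectangles with vertices in a subset of F^5 *)

Section Energy.
Variables (R : realType) (F : finFieldType) (e : F -> R[i]).
Hypotheses (eP : additive_character e) (e_nontriv : nontrivial e).
Hypothesis F2 : 2%N \notin [pchar F].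
Local Notation V := 'rV[F]_5.
Local Notation Q := (#|F|%:R : R).
Variable E : {set V}.
Local Notation N := (#|E|%:R : R).

Let Q0 : 0 < Q. Proof. by rewrite ltr0n card_field_gt0. Qed.

Definition richness (a x : V) : nat := #|[set l : F | a + l *: x \in E]|.
Definition poor (a x : V) : bool := (#|F| ^ 2 * richness a x < #|E|)%N.

(** A triple [(a, x, y)] stands for the rectangle [a], [a + x], [a + y], [a + x + y]; degenerate
    ones with a zero side are included. *)
Definition rectangles : {set V * V * V} :=
  [set t | [&& t.1.1 \in E, t.1.1 + t.1.2 \in E, t.1.1 + t.2 \in E,
               t.1.1 + t.1.2 + t.2 \in E & dotp t.1.2 t.2 == 0]].

(** The fourth vertex is forgotten: for fixed [(a, x)] the vertex [a + y] is any point of [E] on the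
    hyperplane through [a] orthogonal to [x], so this is an incidence count. *)
Definition corners : {set V * V * V} :=
  [set t | [&& t.1.1 \in E, t.1.1 + t.1.2 \in E, t.1.1 + t.2 \in E,
               dotp t.1.2 t.2 == 0 & (t.1.2 != 0) && poor t.1.1 t.1.2]].

Definition parallel (x y : V) : bool := [exists l : F, (l != 0) && (y == l *: x)].

Lemma richness_parallel a x y : parallel x y -> richness a y = richness a x.
Proof.
case/existsP => l /andP[l0 /eqP ->]; rewrite /richness -!sum1_card.
rewrite [RHS](reindex_inj (mulIf l0)); apply: eq_bigl => s.
by rewrite !inE scalerA.
Qed.

Lemma nparallel_free x y : x != 0 -> y != 0 -> ~~ parallel x y ->
  forall a b, a *: x + b *: y = 0 -> a = 0 /\ b = 0.
Proof.
move=> x0 y0 npar a b /eqP; have [->|b0] := eqVneq b 0.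
  by rewrite scale0r addr0 scaler_eq0 (negPf x0) orbF => /eqP.
rewrite addr_eq0 => /eqP h; case/existsP: npar; exists (- a / b).
have -> : y == (- a / b) *: x.
  by rewrite mulrC -scalerA scaleNr h opprK scalerA mulVf // scale1r.
rewrite andbT; apply: contra y0 => /eqP h0.
have /eqP : b *: y = 0.
  by apply: (can_inj (@opprK _)); rewrite -h; move/(congr1 (fun z => - (b * z) *: x)): h0;
     rewrite mulrC divfK // opprK mulr0 !oppr0 scale0r.
by rewrite scaler_eq0 (negPf b0).
Qed.

(* Second moment of the number of hyperplanes, weighted by poor pairs, through a point. *)
Lemma corners_bound : #|corners|%:R <= 2%:R * (N ^+ 3 / Q) + Q ^+ 2 * N ^+ 2.
Proof.
pose S := [set i : V * V | [&& i.1 \in E, i.1 + i.2 \in E, i.2 != 0 & poor i.1 i.2]].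
pose h (i : V * V) b := dotp (b - i.1) i.2 == 0.
(* Hyperplanes with parallel normals are equal or disjoint, and [r] selects the equal ones. Other
   pairs have no excess over the independent count. *)
pose r (i j : V * V) := parallel i.2 j.2 && (dotp i.2 (j.1 - i.1) == 0).
have cardS : #|S|%:R <= N ^+ 2 :> R.
  rewrite -natrX ler_nat -mulnn -cardsX.
  rewrite -(card_imset S (_ : injective (fun i => (i.1, i.1 + i.2)))); last first.
    by move=> [a x] [b y] /= [->] /addrI ->.
  apply/subset_leq_card/subsetP => _ /imsetP[[a x] + ->].
  by rewrite !inE /= => /and4P[-> ->].
have cornersE : #|corners|%:R = \sum_(b in E) \sum_(i in S) (h i b)%:R :> R.
  rewrite exchange_big /=.
  have inj : injective (fun t : V * V * V => (t.1, t.1.1 + t.2)).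
    by move=> [[a x] y] [[b z] w] /= [-> ->] /addrI ->.
  rewrite -(card_imset corners inj).
  rewrite (_ : [set _ | _ in _] =
    [set p : (V * V) * V | (p.1 \in S) && ((p.2 \in E) && h p.1 p.2)]); last first.
    apply/setP => -[[a x] b]; rewrite !inE /h /=; apply/imsetP/idP.
      move=> [[[a' x'] y] tE [-> -> ->]]; move: tE; rewrite inE /=.
      move=> /and5P[aE axE ayE xy /andP[x0 px]].
      by rewrite aE axE x0 px ayE (addrC a') addrK dotpC xy.
    move=> /andP[/and4P[aE axE x0 px] /andP[bE bx]]; exists (a, x, b - a).
      by rewrite inE /= aE axE x0 px (addrC a (b - a)) subrK bE (dotpC x) bx.
    by rewrite /= (addrC a) subrK.
  rewrite (card_dep_pairs S (fun i b => (b \in E) && h i b)) natr_sum; apply: eq_bigr => i _.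
  rewrite (card_indicator _ R) [RHS]big_mkcond; apply: eq_bigr => b _ /=.
  by case: (b \in E).
pose Y : R := \sum_(i in S) \sum_(j in S) (r i j)%:R.
have := @incidence_variance R _ _ setT E S h r Q (Q ^+ 4) Q0 (subsetT E).
rewrite -cornersE -/Y cardsT card_mx mul1n => var.
have {}var : (#|corners|%:R - #|S|%:R * N / Q) ^+ 2 <= N * (Q ^+ 4 * Y).
  apply: var => [[a x]|[a x] [a' x']]; rewrite !inE /= => /and4P[_ _ x0 _].
    rewrite -natrM; congr _%:R; rewrite -(card_hyperplane eP e_nontriv (dotp a x) x0).
    congr muln; apply: eq_card => b; by rewrite !inE /h /= dotpBl subr_eq0.
  move=> /and4P[_ _ x'0 _]; have [par|npar] := boolP (parallel x x'); last first.
    rewrite /r (negPf npar) mulr0 addr0 ler_pdivlMr ?exprn_gt0 // -natrX -natrM ler_nat mulnC.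
    rewrite -(card_hyperplaneI eP e_nontriv (dotp a x) (dotp a' x') (nparallel_free x0 x'0 npar)).
    rewrite leq_mul2l; apply/orP; right; apply: eq_leq; apply: eq_card => b.
    by rewrite !inE /h /= !dotpBl !subr_eq0.
  rewrite /r par /=; have [xa|xa] := boolP (_ == 0); last first.
    rewrite (_ : [set _ in _ | _] = set0) ?cards0 ?mulr0 ?addr0 ?divr_ge0 ?exprn_ge0 //.
    apply/setP => b; rewrite !inE /h /=; case/existsP: par => l /andP[l0 /eqP ->].
    rewrite dotpZr mulf_eq0 (negPf l0) /= !dotpBl !subr_eq0; apply: contraNF xa.
    by move=> /andP[/eqP h1 /eqP h2]; rewrite dotpC dotpBl -h1 -h2 subrr.
  rewrite mulr1 -[leLHS]add0r lerD ?divr_ge0 ?exprn_ge0 //.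
  rewrite -natrX ler_nat -(leq_pmul2l (@card_field_gt0 F)) -expnS.
  rewrite -(card_hyperplane eP e_nontriv (dotp a x) x0) leq_mul2l; apply/orP; right.
  apply: subset_leq_card; apply/subsetP => b.
  by rewrite !inE /h /= dotpBl subr_eq0 => /andP[].
(* Given [(a, x)] in [S] and [b] in [E] on its hyperplane, at most [N / Q ^+ 2] vectors [y] parallel
   to [x] have [(b, y)] in [S], since the line through [b] must be poor. The variance bound thus
   becomes a quadratic inequality for [#|corners|]. *)
have Yle : Q ^+ 2 * Y <= #|corners|%:R * N.
  rewrite cornersE exchange_big mulr_sumr [leRHS]mulr_suml; apply: ler_sum => -[a x] aS.
  have -> : \sum_(j in S) (r (a, x) j)%:R =
      \sum_(b in E) (h (a, x) b)%:R * #|[set y | parallel x y && ((b, y) \in S)]|%:R :> R.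
    rewrite big_mkcond [RHS]big_mkcond.
    transitivity (\sum_b \sum_y
      (if (b, y) \in S then (h (a, x) b && parallel x y)%:R else 0 : R)).
      rewrite pair_bigA /=; apply: eq_bigr => -[b y] _ /=.
      by rewrite /r /h /= (dotpC x) andbC.
    apply: eq_bigr => b _; have [bE|bE] := boolP (b \in E).
      rewrite (card_indicator _ R) mulr_sumr; apply: eq_bigr => y _.
      by rewrite -natrM mulnb andbA; case: (_ \in S); rewrite ?andbT ?andbF.
    by apply: big1 => y _; rewrite inE /= (negPf bE).
  rewrite mulr_sumr mulr_suml; apply: ler_sum => b bE.
  rewrite mulrCA ler_wpM2l // -natrX -natrM ler_nat.
  have [->|[y]] := set_0Vmem [set y | parallel x y && ((b, y) \in S)].
    by rewrite cards0 muln0.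
  rewrite !inE /= => /andP[par /and4P[_ _ _]].
  rewrite /poor (richness_parallel _ par) => /ltnW; apply: leq_trans.
  rewrite leq_mul2l; apply/orP; right.
  apply: leq_trans (leq_imset_card (fun l => l *: x) [set l | b + l *: x \in E]).
  apply: subset_leq_card; apply/subsetP => z.
  rewrite !inE /= => /andP[/existsP[l /andP[_ /eqP ->]] /and4P[_ bz _ _]].
  by apply/imsetP; exists l; rewrite ?inE.
have m0 : 0 <= #|S|%:R * N / Q by rewrite divr_ge0 ?mulr_ge0.
have le1 : #|S|%:R * N / Q <= N ^+ 3 / Q.
  by rewrite ler_pM2r ?invr_gt0 // exprSr ler_wpM2r.
apply: le_trans (_ : 2%:R * (#|S|%:R * N / Q) + Q ^+ 2 * N ^+ 2 <= _); last first.
  by rewrite lerD2r ler_wpM2l.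
apply: le_of_sqr_le => //; first by rewrite mulr_ge0 ?exprn_ge0.
apply: le_trans var _.
have -> : N * (Q ^+ 4 * Y) = (N * Q ^+ 2) * (Q ^+ 2 * Y) by ring.
have -> : Q ^+ 2 * N ^+ 2 * #|corners|%:R = (N * Q ^+ 2) * (#|corners|%:R * N) by ring.
by rewrite ler_wpM2l ?mulr_ge0 ?exprn_ge0.
Qed.

Definition rich_rectangles : {set V * V * V} :=
  [set t in rectangles | (dotp t.1.2 t.1.2 != 0) && ~~ poor t.1.1 t.1.2].

(* A rich line through [a] in a non-isotropic direction [x] gives many triples
   [(a + l x, a + y, a + x + y)] in [E ^ 3], and each of them determines [l]
   because [y] is orthogonal to [x]. *)
Lemma rich_rectangles_bound : (#|rich_rectangles| <= #|F| ^ 2 * #|E| ^ 2)%N.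
Proof.
pose P (t : V * V * V) (l : F) := t.1.1 + l *: t.1.2 \in E.
have inj : {in [set p | (p.1 \in rich_rectangles) && P p.1 p.2] &, injective
    (fun p : (V * V * V) * F =>
      (p.1.1.1 + p.2 *: p.1.1.2, p.1.1.1 + p.1.2, p.1.1.1 + p.1.1.2 + p.1.2))}.
  move=> [[[a x] y] l] [[[b z] w] k]; rewrite !inE /=.
  move=> /andP[/andP[/and5P[_ _ _ _ /eqP xy] /andP[xx _]] _].
  move=> /andP[/andP[/and5P[_ _ _ _ /eqP zw] _] _] [h1 h2 h3].
  have xz : x = z.
    by apply: (addrI (a + y)); rewrite addrAC h3 h2 addrAC.
  rewrite -{z}xz in h1 h3 zw *.
  have lk : l = k.
    apply: (mulIf xx); rewrite -!dotpZl.
    have := congr1 (dotp x) h1; have := congr1 (dotp x) h2.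
    rewrite !dotpDr xy zw !addr0 => -> /addrI.
    by rewrite !dotpZr !dotpZl.
  rewrite -{k}lk in h1 *; have ab : a = b by apply: addIr h1.
  by move: h2; rewrite -ab => /addrI ->.
have le3 : (#|[set p : (V * V * V) * F | (p.1 \in rich_rectangles) && P p.1 p.2]|
    <= #|E| ^ 3)%N.
  rewrite -(card_in_imset inj) (_ : #|E| ^ 3 = #|setX (setX E E) E|)%N; last first.
    by rewrite !cardsX; ring.
  apply/subset_leq_card/subsetP => _ /imsetP[[[[a x] y] l] + ->].
  by rewrite !inE /P /= => /andP[/andP[/and5P[_ _ -> -> _] _] ->].
have le4 : (#|rich_rectangles| * #|E| <= #|F| ^ 2 * #|E| ^ 3)%N.
  apply: leq_trans (leq_mul (leqnn _) le3).
  rewrite card_dep_pairs big_distrr -sum_nat_const leq_sum // => t.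
  by rewrite !inE -leqNgt => /and3P[_ _].
have [E0|E0] := posnP #|E|; last first.
  by rewrite -(leq_pmul2r E0) -mulnA -expnSr.
rewrite E0 exp0n // muln0 leqn0 cards_eq0 -subset0; apply/subsetP => t; rewrite !inE.
by rewrite (cards0_eq E0) inE.
Qed.

Definition isotropic_rectangles : {set V * V * V} :=
  [set t in rectangles | [&& t.1.2 != 0, t.2 != 0, dotp t.1.2 t.1.2 == 0
                           & dotp t.2 t.2 == 0]].

(** The cone has [q^4] points. By [card_isotropicI] the hyperplane orthogonal to a nonzero isotropic
    vector meets it in exactly [q^3] points, and two such hyperplanes with non-parallel normals in
    [q^2], as if independent. Only parallel pairs, at most [q] per vector, contribute to the
    variance. *)
Lemma isotropic_orthogonal_bound (A : {set V}) :
  (forall x, x \in A -> x != 0) -> (forall x, x \in A -> dotp x x = 0) ->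
  \sum_(x in A) \sum_(y in A) (dotp x y == 0)%:R <=
    #|A|%:R ^+ 2 / Q + Q ^+ 2 * #|A|%:R.
Proof.
move=> A0 Ai; pose D := [set b : V | dotp b b == 0].
have card5 (y z : V) : dotp y y = 0 -> dotp z z = 0 ->
    #|[set b in D | (dotp b y == 0) && (dotp b z == 0)]|%:R =
    Q ^+ 2 * #|[set p : F * F | p.1 *: y + p.2 *: z == 0]|%:R.
  move=> yy zz; have := card_isotropicI eP e_nontriv F2 yy zz.
  rewrite (expnD _ 3 2) -mulnA => /eqP.
  rewrite eqn_pmul2l ?expn_gt0 ?card_field_gt0 // => /eqP h.
  rewrite -natrX -natrM -h; congr _%:R; apply: eq_card => b; by rewrite !inE.
have cardD : #|D|%:R = Q ^+ 4.
  have := card5 0 0 (dotp0r _) (dotp0r _).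
  rewrite (_ : [set p : F * F | p.1 *: (0 : V) + p.2 *: 0 == 0] = setT); last first.
    by apply/setP => p; rewrite !inE !scaler0 addr0 eqxx.
  rewrite cardsT card_prod natrM (_ : Q ^+ 2 * (Q * Q) = Q ^+ 4); last by ring.
  move=> <-; congr _%:R; apply: eq_card => b; by rewrite !inE dotp0r eqxx !andbT.
have := @incidence_variance R _ _ D A A (fun y b => dotp b y == 0) parallel
  Q (Q ^+ 3) Q0.
have AD : A \subset D by apply/subsetP => x /Ai h; rewrite inE h.
have kernel_le (y z : V) : y != 0 ->
    (#|[set p : F * F | (p.1 *: y + p.2 *: z == 0)%R]| <= #|F|)%N.
  move=> y0; rewrite -(card_in_imset (f := snd)) ?max_card // => -[a b] [c d].
  rewrite !inE !addr_eq0 /= => /eqP h1 /eqP h2 bd; rewrite -bd in h2 *.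
  have /eqP : (a - c) *: y = 0 by rewrite scalerBl h1 h2 subrr.
  by rewrite scaler_eq0 (negPf y0) orbF subr_eq0 => /eqP ->.
move=> /(_ AD) var.
have mean y : y \in A -> Q * #|[set b in D | dotp b y == 0]|%:R = #|D|%:R.
  move=> yA; have := card5 y 0 (Ai y yA) (dotp0r _).
  rewrite (_ : #|[set p : F * F | _]| = #|setX [set (0 : F)] [set: F]|); last first.
    apply: eq_card => p.
    by rewrite !inE scaler0 addr0 scaler_eq0 (negPf (A0 y yA)) orbF andbT.
  rewrite cardsX cards1 mul1n cardsT cardD => h.
  rewrite (_ : Q ^+ 4 = Q * (Q ^+ 2 * Q)); last by ring.
  rewrite -h; congr (_ * _%:R); apply: eq_card => b.
  by rewrite !inE dotp0r eqxx andbT.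
have {}var := var mean _.
have {}var : (\sum_(b in A) \sum_(i in A) (dotp b i == 0)%:R -
    #|A|%:R * #|A|%:R / Q) ^+ 2 <=
    #|A|%:R * (Q ^+ 3 * \sum_(i in A) \sum_(j in A) (parallel i j)%:R).
  apply: var => y z yA zA; rewrite (card5 _ _ (Ai y yA) (Ai z zA)) cardD.
  have -> : Q ^+ 4 / Q ^+ 2 = Q ^+ 2 by field; rewrite gt_eqF.
  have [par|npar] := boolP (parallel y z).
    rewrite mulr1 -[leLHS]add0r lerD ?exprn_ge0 // [leRHS]exprSr.
    by rewrite ler_wpM2l ?exprn_ge0 // ler_nat kernel_le ?A0.
  rewrite mulr0 addr0 ler_piMr ?exprn_ge0 // lern1.
  apply: (@leq_trans #|[set (0 : F, 0 : F)]|); last by rewrite cards1.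
  apply/subset_leq_card/subsetP => -[a b]; rewrite !inE /= => /eqP.
  by move=> /(nparallel_free (A0 y yA) (A0 z zA) npar)[-> ->].
have Yle : \sum_(i in A) \sum_(j in A) (parallel i j)%:R <= #|A|%:R * Q.
  rewrite mulr_natl -sumr_const; apply: ler_sum => x xA.
  apply: (@le_trans _ _ (\sum_j (parallel x j)%:R)).
    by rewrite [leLHS]big_mkcond; apply: ler_sum => y _; case: ifP.
  rewrite -(card_indicator _ R) ler_nat.
  apply: leq_trans (leq_trans (leq_imset_card (fun l => l *: x) [set: F]) (max_card _)).
  apply/subset_leq_card/subsetP => y; rewrite inE => /existsP[l /andP[_ /eqP ->]].
  by apply/imsetP; exists l.
rewrite -lerBlDl -expr2 in var *; rewrite leNgt; apply/negP => lt.
have : (Q ^+ 2 * #|A|%:R) ^+ 2 < #|A|%:R * (Q ^+ 3 * (#|A|%:R * Q)).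
  have c0 : 0 <= Q ^+ 2 * #|A|%:R by rewrite mulr_ge0 ?exprn_ge0.
  apply: lt_le_trans (le_trans var _).
    by rewrite ltr_pXn2r ?nnegrE // (le_trans _ (ltW lt)).
  by rewrite !ler_wpM2l ?exprn_ge0.
by rewrite (_ : _ * (_ * _) = (Q ^+ 2 * #|A|%:R) ^+ 2) ?ltxx //; ring.
Qed.

(** For each vertex [a] the two sides form an orthogonal pair in a set of at most [N] isotropic
    vectors; the fourth vertex is ignored. *)
Lemma isotropic_rectangles_bound :
  #|isotropic_rectangles|%:R <= N ^+ 3 / Q + Q ^+ 2 * N ^+ 2.
Proof.
pose A a := [set x : V | [&& a + x \in E, x != 0 & dotp x x == 0]].
have cardA a : #|A a|%:R <= N.
  rewrite ler_nat -(card_imset _ (addrI a)); apply/subset_leq_card/subsetP.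
  by move=> _ /imsetP[x + ->]; rewrite inE => /and3P[].
apply: (@le_trans _ _ (\sum_(a in E) \sum_(x in A a) \sum_(y in A a) (dotp x y == 0)%:R)).
  pose P a (p : V * V) := (p.1 \in A a) && ((p.2 \in A a) && (dotp p.1 p.2 == 0)).
  have -> : \sum_(a in E) \sum_(x in A a) \sum_(y in A a) (dotp x y == 0)%:R =
      #|[set t : V * (V * V) | (t.1 \in E) && P t.1 t.2]|%:R :> R.
    rewrite card_dep_pairs natr_sum; apply: eq_bigr => a _.
    rewrite (card_dep_pairs (A a) (fun x y => (y \in A a) && (dotp x y == 0))) natr_sum.
    apply: eq_bigr => x _; rewrite (card_indicator _ R) [LHS]big_mkcond.
    by apply: eq_bigr => y _; case: (_ \in _).
  rewrite ler_nat.
  rewrite -(card_imset _ (_ : injective (fun t : V * V * V => (t.1.1, (t.1.2, t.2))))).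
    apply/subset_leq_card/subsetP => _ /imsetP[[[a x] y] + ->].
    by rewrite !inE /P !inE /= => /andP[/and5P[-> -> -> _ ->] /and4P[-> -> -> ->]].
  by move=> [[a x] y] [[b z] w] [-> -> ->].
apply: (@le_trans _ _ (\sum_(a in E) (N ^+ 2 / Q + Q ^+ 2 * N))).
  apply: ler_sum => a _; apply: le_trans (isotropic_orthogonal_bound _ _) _.
  - by move=> x; rewrite inE => /and3P[].
  - by move=> x; rewrite inE => /and3P[_ _ /eqP].
  by rewrite lerD ?ler_wpM2l ?exprn_ge0 // ler_wpM2r ?invr_ge0 // lerXn2r ?nnegrE.
by rewrite sumr_const -[leLHS]mulr_natr mulrDl le_eqVlt; apply/orP; left; apply/eqP; ring.
Qed.

(** Up to exchanging the sides, a rectangle has a zero side, a side on a poor line, or a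
    non-isotropic side on a rich line. Otherwise both sides are nonzero and isotropic. *)
Lemma rectangles_bound :
  #|rectangles|%:R <= 7%:R * (N ^+ 3 / Q + Q ^+ 2 * N ^+ 2).
Proof.
pose swap (t : V * V * V) := (t.1.1, t.2, t.1.2).
have swapK : involutive swap by move=> [[a x] y].
pose Z1 := [set t in rectangles | t.1.2 == 0].
have Z1le : (#|Z1| <= #|E| ^ 2)%N.
  rewrite -mulnn -cardsX -(card_in_imset (f := fun t => (t.1.1, t.1.1 + t.2))).
    apply/subset_leq_card/subsetP => _ /imsetP[[[a x] y] + ->].
    by rewrite !inE /= => /andP[/and5P[-> _ -> _ _] _].
  move=> [[a x] y] [[b z] w]; rewrite !inE /=.
  by move=> /andP[_ /eqP ->] /andP[_ /eqP ->] [-> /addrI ->].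
pose U := Z1 :|: (corners :|: rich_rectangles).
have sub : rectangles \subset U :|: (swap @: U :|: isotropic_rectangles).
  apply/subsetP => -[[a x] y] tE; have yxE : swap (a, x, y) \in rectangles.
    by move: tE; rewrite !inE /= addrAC dotpC => /and5P[-> -> -> -> ->].
  rewrite in_setU; have [//|xU] := boolP ((a, x, y) \in U).
  rewrite in_setU; have [|yU] := boolP (swap (a, x, y) \in U).
    by move=> /(imset_f swap); rewrite swapK => ->; rewrite orbT.
  move: xU yU; rewrite !inE /=.
  move: tE yxE; rewrite !inE /=.
  move=> /and5P[-> -> -> -> xy] /and5P[_ _ _ -> yx]; rewrite xy yx /=.
  by case: (x == 0); case: (y == 0); case: (poor a x); case: (poor a y);
    case: (dotp x x == 0); case: (dotp y y == 0); rewrite ?orbT.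
have Ule : #|U|%:R <= N ^+ 2 + #|corners|%:R + Q ^+ 2 * N ^+ 2 :> R.
  apply: (@le_trans _ _ (#|Z1| + (#|corners| + #|rich_rectangles|))%:R).
    rewrite ler_nat; apply: leq_trans (leq_card_setU _ _) _.
    by rewrite leq_add2l leq_card_setU.
  rewrite !natrD addrA lerD // ?lerD2r -!natrX ?ler_nat //.
  by rewrite -natrM ler_nat rich_rectangles_bound.
have le1 : #|rectangles|%:R <= 2%:R * #|U|%:R + #|isotropic_rectangles|%:R :> R.
  rewrite -natrM -natrD ler_nat mul2n -addnn -addnA.
  apply: leq_trans (subset_leq_card sub) _.
  apply: leq_trans (leq_card_setU _ _) _; rewrite leq_add2l.
  apply: leq_trans (leq_card_setU _ _) _; rewrite leq_add2r.
  exact: leq_imset_card.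
have Q1 : N ^+ 2 <= Q ^+ 2 * N ^+ 2.
  by rewrite ler_peMl ?exprn_ge0 // exprn_ege1 // ler1n card_field_gt0.
have A0 : 0 <= N ^+ 3 / Q by rewrite divr_ge0 ?exprn_ge0.
(* With [A] and [B] the two terms, [#|U| <= 2 A + 3 B], and the total is at most [5 A + 7 B]. *)
move: corners_bound isotropic_rectangles_bound Ule le1 Q1 A0.
by move: (N ^+ 3 / Q) (Q ^+ 2 * N ^+ 2) => A B; lra.
Qed.

End Energy.

(** * The bilinear estimate *)

Section Extension.
Variables (R : realType) (F : finFieldType) (e : F -> R[i]).
Hypotheses (eP : additive_character e) (e_nontriv : nontrivial e).
Hypothesis F2 : 2%N \notin [pchar F].
Local Notation V := 'rV[F]_5.
Local Notation X := ('rV[F]_5 * F)%type.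
Local Notation q := (#|F|%:R : R[i]).
Local Notation Q := (#|F|%:R : R).

Definition phase (x : X) (xi : V) : R[i] := e (dotp x.1 xi + x.2 * dotp xi xi).

Lemma phase_orthogonal (y z : V) (s t : F) :
  \sum_(w : X) e (dotp w.1 y + w.2 * s) * conjc (e (dotp w.1 z + w.2 * t)) =
    q ^+ 6 * ((y == z) && (s == t))%:R.
Proof.
have -> : q ^+ 6 * ((y == z) && (s == t))%:R =
    q ^+ 5 * (y - z == 0)%:R * (q * (s - t == 0)%:R).
  by rewrite !subr_eq0 -mulnb natrM; ring.
rewrite -(sum_char_dotp eP e_nontriv) (indicator_char eP e_nontriv).
rewrite big_distrlr pair_big /=; apply: eq_bigr => w _.
by rewrite (char_conj eP) -!(charD eP); congr e; rewrite dotpBr; ring.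
Qed.

(* The quadruples with [y1 + y2 = y3 + y4] and [|y1|^2 + |y2|^2 = |y3|^2 + |y4|^2]
   are the rectangles with diagonal [y1 y2]. *)
Lemma fourth_moment_le (k : V -> R[i]) (G : {set V}) :
  (forall y, normc (k y) <= (y \in G)%:R) ->
  \sum_(w : X) normc (\sum_y k y * phase w y) ^+ 4 <= Q ^+ 6 * #|rectangles G|%:R.
Proof.
move=> kG; pose c (p : V * V) := k p.1 * k p.2.
pose r (p p' : V * V) := (p.1 + p.2 == p'.1 + p'.2) &&
  (dotp p.1 p.1 + dotp p.2 p.2 == dotp p'.1 p'.1 + dotp p'.2 p'.2).
have := @orthogonal_moment R X (V * V)%type (fun p w =>
  e (dotp w.1 (p.1 + p.2) + w.2 * (dotp p.1 p.1 + dotp p.2 p.2))) c (q ^+ 6) r.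
move=> /(_ (fun p p' => phase_orthogonal _ _ _ _)) moment.
have {}moment : real_complex R (\sum_(w : X) normc (\sum_y k y * phase w y) ^+ 4) =
    q ^+ 6 * \sum_p \sum_(p' | r p p') c p * conjc (c p').
  rewrite -moment rmorph_sum /=; apply: eq_bigr => w _.
  rewrite (exprM _ 2 2) -normcX normc_sqr; congr (_ * conjc _);
  rewrite expr2 big_distrlr pair_big /=; apply: eq_bigr => p _;
  by rewrite mulrACA -(charD eP) dotpDr; congr (_ * e _); ring.
have -> : \sum_(w : X) normc (\sum_y k y * phase w y) ^+ 4 =
    normc (q ^+ 6 * \sum_p \sum_(p' | r p p') c p * conjc (c p')).
  rewrite -moment normc_real ger0_norm // sumr_ge0 // => w _.
  by rewrite exprn_ge0 // normc_ge0.
rewrite normcM normcX normc_card ler_wpM2l ?exprn_ge0 //.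
apply: le_trans (normc_sum _ _) _.
apply: (@le_trans _ _ (\sum_p \sum_(p' | r p p')
    ((p \in setX G G) && (p' \in setX G G))%:R)).
  apply: ler_sum => p _; apply: le_trans (normc_sum _ _) _; apply: ler_sum => p' _.
  rewrite normcM normc_conj !normcM !inE -!mulnb !natrM.
  by do !apply: ler_pM; rewrite ?mulr_ge0 ?normc_ge0.
under eq_bigr do rewrite big_mkcond /=.
rewrite pair_bigA /=.
rewrite (eq_bigr (fun p : (V * V) * (V * V) =>
  ((p.1 \in setX G G) && (p.2 \in setX G G) && r p.1 p.2)%:R)); last first.
  by move=> p _; case: (r _ _); rewrite ?andbT ?andbF.
rewrite -(card_indicator _ R) ler_nat.
(* Taking [y1] as the base vertex, the differences [y3 - y1] and [y4 - y1] are the sides. The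
   condition on squares then says that twice their dot product vanishes, which uses odd
   characteristic. *)
rewrite -(card_in_imset (f := fun p : (V * V) * (V * V) =>
  (p.1.1, p.2.1 - p.1.1, p.2.2 - p.1.1))).
  apply/subset_leq_card/subsetP => _ /imsetP[[[a b] [c' d]] + ->].
  rewrite !inE /r /= => /andP[/andP[/andP[aG bG] /andP[cG dG]] /andP[/eqP h1 /eqP h2]].
  rewrite aG !(addrC a) !subrK cG dG addrA.
  have -> : c' + d - a = b by rewrite -h1 addrC addKr.
  rewrite bG /=; move: h2; have -> : b = c' + d - a by rewrite -h1 addrC addKr.
  rewrite !dotpE (dotpC d c') !(dotpC _ a) => h2.
  apply/eqP/(mulfI (two_neq0 F2)); rewrite mulr0; move/eqP: h2; rewrite -subr_eq0 => /eqP <-.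
  by ring.
move=> [[a b] [c' d]] [[a' b'] [c'' d']]; rewrite !inE /r /=.
move=> /andP[_ /andP[/eqP h1 _]] /andP[_ /andP[/eqP h2 _]] [aa].
rewrite -aa => /addIr cc /addIr dd; rewrite -aa -cc -dd in h2 *.
by have /addrI -> : a + b = a + b' by rewrite h1 h2.
Qed.

(* The Fourier transform of [g] at the point [(xi, xi.xi)] of the paraboloid; [F^6] is
   encoded as [F^5 * F] until [embed]. *)
Definition hat (g : X -> R[i]) (xi : V) : R[i] := \sum_x g x * phase x xi.

(* [q^5] times the form [<g, h * ((d sigma)^\vee - delta)>]. *)
Definition pairing (g h : X -> R[i]) : R[i] :=
  \sum_xi hat g xi * conjc (hat h xi) - q ^+ 5 * \sum_x g x * conjc (h x).

(* The pseudo-conformal change of variables seen from height [a]. *)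
Definition kernel_phase (x : X) (a : F) : X :=
  ((2%:R * (x.2 - a))^-1 *: x.1, - (4%:R * (x.2 - a))^-1).

(** Completing the square gives a phase quadratic in [x.1 - x'.1]; expanding it, the part depending
    on [x'.1] is again a phase on the paraboloid. *)
Lemma phase_kernel (x x' : X) : x.2 != x'.2 ->
  \sum_xi phase x xi * conjc (phase x' xi) =
    gauss e 5 (x.2 - x'.2) * e (- (dotp x.1 x.1 / (4%:R * (x.2 - x'.2)))) *
    phase (kernel_phase x x'.2) x'.1.
Proof.
move=> xx'; have r0 : x.2 - x'.2 != 0 by rewrite subr_eq0.
under eq_bigr => xi _.
  rewrite (char_conj eP) -(charD eP) (_ : _ - _ = (x.2 - x'.2) * dotp xi xi +
    dotp xi (x.1 - x'.1)); last by rewrite dotpBr !(dotpC xi); ring.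
  over.
rewrite (gauss_shift eP F2) // -mulrA -(charD eP) /kernel_phase /=.
congr (_ * e _); rewrite !dotpE (dotpC x'.1 x.1).
by field; rewrite r0 four_neq0 // two_neq0.
Qed.

(** At equal heights the quadratic terms cancel and only the diagonal remains: this is the term
    subtracted in [pairing]. *)
Lemma phase_kernel_diag (x x' : X) : x.2 = x'.2 ->
  \sum_xi phase x xi * conjc (phase x' xi) = q ^+ 5 * (x == x')%:R.
Proof.
case: x x' => [y t] [y' t'] /= <-; rewrite xpair_eqE eqxx andbT.
rewrite -(char_dotp_orthogonal eP e_nontriv); apply: eq_bigr => xi _.
rewrite /phase /= !(charD eP) rmorphM /= !(dotpC _ xi) mulrACA.
by rewrite -(normc_sqr (e (t * _))) eP.1 expr1n mulr1.
Qed.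

Lemma pairingE (g h : X -> R[i]) :
  pairing g h = \sum_a \sum_(x | x.2 != a)
    g x * (gauss e 5 (x.2 - a) * e (- (dotp x.1 x.1 / (4%:R * (x.2 - a))))) *
    \sum_y conjc (h (y, a)) * phase (kernel_phase x a) y.
Proof.
have -> : pairing g h = \sum_x' \sum_(x | x.2 != x'.2)
    g x * conjc (h x') * \sum_xi phase x xi * conjc (phase x' xi).
  rewrite /pairing; have -> : \sum_xi hat g xi * conjc (hat h xi) =
      \sum_x' \sum_x g x * conjc (h x') * \sum_xi phase x xi * conjc (phase x' xi).
    under eq_bigr do rewrite rmorph_sum /= big_distrlr exchange_big /=.
    rewrite exchange_big; apply: eq_bigr => x' _.
    rewrite exchange_big; apply: eq_bigr => x _ /=.
    by rewrite mulr_sumr; apply: eq_bigr => xi _; rewrite rmorphM /= mulrACA.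
  rewrite mulr_sumr -sumrB; apply: eq_bigr => x' _.
  rewrite (bigID (fun x : X => x.2 == x'.2)) /= [X in X + _ - _](_ : _ =
    q ^+ 5 * (g x' * conjc (h x'))); first by rewrite [X in X - _]addrC addrK.
  rewrite (bigD1 x') //= (phase_kernel_diag (erefl x'.2)) eqxx mulr1 mulrC big1 ?addr0 //.
  by move=> x /andP[/eqP h1 xx']; rewrite phase_kernel_diag // (negPf xx') !mulr0.
transitivity (\sum_y \sum_a \sum_(x : X | x.2 != a)
    g x * conjc (h (y, a)) * \sum_xi phase x xi * conjc (phase (y, a) xi)).
  by rewrite pair_bigA; apply: eq_bigr => -[y a].
rewrite exchange_big; apply: eq_bigr => a _ /=.
rewrite exchange_big; apply: eq_bigr => x xa /=.
rewrite mulr_sumr; apply: eq_bigr => y _.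
by rewrite (@phase_kernel x (y, a)) //=; ring.
Qed.

Lemma pairing_conj (g h : X -> R[i]) : pairing h g = conjc (pairing g h).
Proof.
rewrite /pairing rmorphB rmorphM rmorphXn !rmorph_sum rmorph_nat /=.
congr (_ - _ * _); apply: eq_bigr => x _; by rewrite rmorphM /= conjcK mulrC.
Qed.

Lemma normc_gauss5 r : r != 0 -> normc (gauss e 5 r) = Q ^+ 2 * Num.sqrt Q.
Proof.
move=> r0; apply/eqP; rewrite -(eqrXn2 (n := 2)) ?normc_ge0 ?mulr_ge0 ?sqrtr_ge0 //.
rewrite exprMn sqr_sqrtr // -exprM -exprSr; apply/eqP; apply: (@complexI R).
by rewrite normc_sqr (gauss_norm eP e_nontriv F2) // rmorphXn rmorph_nat.
Qed.

Lemma sum_pow4_le (T : finType) (A : {set T}) (f : T -> R) :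
  (\sum_(x in A) f x) ^+ 4 <= #|A|%:R ^+ 3 * \sum_(x in A) f x ^+ 4.
Proof.
rewrite (exprM _ 2 2); apply: (@le_trans _ _ ((#|A|%:R * \sum_(x in A) f x ^+ 2) ^+ 2)).
  by rewrite lerXn2r ?nnegrE ?sqr_ge0 ?mulr_ge0 ?sumr_ge0 ?sqr_sum_le // => x _; rewrite sqr_ge0.
rewrite exprMn [_ ^+ 3]exprSr -mulrA ler_wpM2l ?sqr_ge0 //.
apply: le_trans (sqr_sum_le _ _) _.
by under [in leRHS]eq_bigr do rewrite (exprM _ 2 2).
Qed.

(** Hölder with exponents 4/3 and 4, then the fourth moment, since [kernel_phase] at fixed height is
    injective. The fourth root of the energy bound would contain [q^(5/4) |G|^(3/4)]; this is the
    geometric mean of the two terms in the conclusion. *)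
Lemma slice_bound (E : {set X}) (k : V -> R[i]) (G : {set V}) (a : F) :
  (forall y, normc (k y) <= (y \in G)%:R) ->
  \sum_(x in E | x.2 != a) normc (\sum_y k y * phase (kernel_phase x a) y) <=
    2%:R * Num.sqrt (Num.sqrt (#|E|%:R ^+ 3)) *
    (Q ^+ 2 * Num.sqrt #|G|%:R + Num.sqrt Q * #|G|%:R).
Proof.
move=> kG; pose f w := normc (\sum_y k y * phase w y).
pose A := [set x in E | x.2 != a].
have f4 : \sum_(x in A) f (kernel_phase x a) ^+ 4 <= Q ^+ 6 * #|rectangles G|%:R.
  have inj : {in A &, injective (kernel_phase^~ a)}.
    move=> [y t] [z s]; rewrite !inE /= => /andP[_ ta] /andP[_ sa] [].
    rewrite -!(subr_eq0 _ a) in ta sa.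
    move=> + /oppr_inj/invr_inj/(mulfI (four_neq0 F2))/addIr ts; rewrite -ts => /scalerI h.
    by rewrite h // invr_neq0 // mulf_neq0 // two_neq0.
  rewrite -(big_imset (fun w => f w ^+ 4) inj) /=.
  apply: le_trans _ (fourth_moment_le kG); rewrite [leLHS]big_mkcond.
  apply: ler_sum => w _; case: ifP => // _; by rewrite exprn_ge0 ?normc_ge0.
rewrite (eq_bigl (fun x => x \in A)) => [|x]; last by rewrite inE.
have Q0 : 0 < Q by rewrite ltr0n card_field_gt0.
have s2 : Num.sqrt Q ^+ 2 = Q by rewrite sqr_sqrtr.
have m2 : Num.sqrt #|G|%:R ^+ 2 = #|G|%:R :> R by rewrite sqr_sqrtr.
have t4 : Num.sqrt (Num.sqrt (#|E|%:R ^+ 3)) ^+ 4 = #|E|%:R ^+ 3 :> R.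
  by rewrite (exprM _ 2 2) !sqr_sqrtr ?exprn_ge0 ?sqrtr_ge0.
move: s2 m2 t4 (sqrtr_ge0 Q) (sqrtr_ge0 (#|G|%:R : R))
  (sqrtr_ge0 (Num.sqrt (#|E|%:R ^+ 3 : R))).
set s := Num.sqrt Q; set m := Num.sqrt #|G|%:R; set t := Num.sqrt _.
move=> s2 m2 t4 s0 m0 t0.
have p0 i j l : 0 <= t ^+ i * (s ^+ j * m ^+ l) by rewrite !mulr_ge0 ?exprn_ge0.
rewrite -(ler_pXn2r (n := 4)) ?nnegrE ?sumr_ge0 // => [|x _|]; first last.
- by rewrite !mulr_ge0 ?addr_ge0 ?mulr_ge0 ?exprn_ge0.
- exact: normc_ge0.
apply: le_trans (sum_pow4_le _ _) _.
apply: (@le_trans _ _ (t ^+ 4 * (Q ^+ 6 * #|rectangles G|%:R))).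
  rewrite ler_pM ?exprn_ge0 ?sumr_ge0 // => [x _|]; first by rewrite exprn_ge0 ?normc_ge0.
  rewrite t4 lerXn2r ?nnegrE // ler_nat; apply/subset_leq_card/subsetP => x.
  by rewrite inE => /andP[].
apply: (@le_trans _ _ (7%:R * (t ^+ 4 * (s ^+ 10 * m ^+ 6)) +
    7%:R * (t ^+ 4 * (s ^+ 16 * m ^+ 4)))).
  rewrite (_ : _ + _ = t ^+ 4 * (Q ^+ 6 * (7%:R *
    (#|G|%:R ^+ 3 / Q + Q ^+ 2 * #|G|%:R ^+ 2)))).
    rewrite !ler_wpM2l ?exprn_ge0 //.
    exact: rectangles_bound eP e_nontriv F2 G.
  rewrite -m2 -s2; field; apply: contraTneq Q0 => s00.
  by rewrite -s2 s00 expr0n ltxx.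
rewrite -s2 -m2.
(* The coefficients 96 and 16 of the two relevant monomials dominate the 7 of [rectangles_bound]. *)
have -> : (2%:R * t * (s ^+ 2 ^+ 2 * m + s * m ^+ 2)) ^+ 4 =
  16%:R * (t ^+ 4 * (s ^+ 16 * m ^+ 4)) + 64%:R * (t ^+ 4 * (s ^+ 13 * m ^+ 5)) +
  96%:R * (t ^+ 4 * (s ^+ 10 * m ^+ 6)) + 64%:R * (t ^+ 4 * (s ^+ 7 * m ^+ 7)) +
  16%:R * (t ^+ 4 * (s ^+ 4 * m ^+ 8)) by ring.
by have := p0 4 16 4; have := p0 4 13 5; have := p0 4 10 6;
  have := p0 4 7 7; have := p0 4 4 8; lra.
Qed.

(** The slice bounds are summed over the [q] heights. Cauchy-Schwarz treats the square roots of the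
    slice sizes, and [|G| <= q^4] makes [|G|] at most [q^2 |G|^(1/2)], so both terms have the same
    size. *)
Lemma pairing_bound (E G : {set X}) (g h : X -> R[i]) :
  (forall x, normc (g x) <= (x \in E)%:R) ->
  (forall x, normc (h x) <= (x \in G)%:R) ->
  (#|G| <= #|F| ^ 4)%N ->
  normc (pairing g h) <=
    4%:R * Q ^+ 5 * (Num.sqrt (Num.sqrt (#|E|%:R ^+ 3)) * Num.sqrt #|G|%:R).
Proof.
move=> gE hG G4; pose S a := [set y | (y, a) \in G].
have cardS : \sum_a #|S a| = #|G|.
  rewrite -[RHS](card_imset _ (_ : injective (fun x : X => (x.2, x.1)))); last first.
    by move=> [y a] [z b] [-> ->].
  rewrite (eq_card (_ : _ =i [set p : F * V | (p.1 \in [set: F]) && ((p.2, p.1) \in G)])).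
    rewrite (card_dep_pairs _ (fun a y => (y, a) \in G)).
    by apply: eq_bigl => a; rewrite inE.
  move=> [a y]; rewrite !inE /=; apply/imsetP/idP => [[[z b] zG [-> ->]]|yG] //.
  by exists (y, a).
set t := Num.sqrt (Num.sqrt _).
have t0 : 0 <= t by apply: sqrtr_ge0.
have Q0 : 0 <= Q by [].
rewrite pairingE; apply: le_trans (normc_sum _ _) _.
apply: (@le_trans _ _ (\sum_a Q ^+ 2 * Num.sqrt Q * (2%:R * t *
    (Q ^+ 2 * Num.sqrt #|S a|%:R + Num.sqrt Q * #|S a|%:R)))).
  apply: ler_sum => a _.
  have le0 : 0 <= Q ^+ 2 * Num.sqrt Q by rewrite mulr_ge0 ?exprn_ge0 ?sqrtr_ge0.
  have kS y : normc (conjc (h (y, a))) <= (y \in S a)%:R by rewrite normc_conj inE.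
  apply: le_trans (ler_wpM2l le0 (slice_bound E a kS)).
  apply: le_trans (normc_sum _ _) _; rewrite mulr_sumr [leRHS]big_mkcondl /=.
  apply: ler_sum => x xa; rewrite !normcM eP.1 mulr1 normc_gauss5 ?subr_eq0 //.
  move: (gE x); case: (x \in E) => [gx|gx].
    by rewrite -mulrA ler_piMl // mulr_ge0 ?normc_ge0 ?mulr_ge0 ?exprn_ge0 ?sqrtr_ge0.
  by have /eqP -> : normc (g x) == 0; rewrite ?eq_le ?gx ?normc_ge0 // !mul0r.
rewrite -!mulr_sumr big_split -!mulr_sumr /= -natr_sum cardS.
have le2 : \sum_a Num.sqrt (#|S a|%:R : R) <= Num.sqrt Q * Num.sqrt #|G|%:R.
  rewrite -sqrtrM // -(ler_pXn2r (n := 2)) ?nnegrE ?sqrtr_ge0 ?sumr_ge0 //.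
  rewrite sqr_sqrtr ?mulr_ge0 // -cardS natr_sum.
  have := sqr_sum_le [set: F] (fun a => Num.sqrt (#|S a|%:R : R)).
  rewrite !(eq_bigl xpredT (fun a => _) (in_setT (T := F))) cardsT => h1.
  apply: le_trans h1 _; rewrite ler_wpM2l //.
    by apply: ler_sum => a _; rewrite sqr_sqrtr.
  by move=> a _; apply: sqrtr_ge0.
have le3 : #|G|%:R <= Q ^+ 2 * Num.sqrt (#|G|%:R : R).
  rewrite -{1}(sqr_sqrtr (_ : 0 <= #|G|%:R :> R)) // expr2 ler_wpM2r ?sqrtr_ge0 //.
  rewrite -(ler_pXn2r (n := 2)) ?nnegrE ?sqrtr_ge0 ?exprn_ge0 // sqr_sqrtr //.
  by rewrite -exprM -natrX ler_nat.
have s2 : Num.sqrt Q ^+ 2 = Q by rewrite sqr_sqrtr.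
apply: (@le_trans _ _ (Q ^+ 2 * Num.sqrt Q * (2%:R * t *
  (Q ^+ 2 * (Num.sqrt Q * Num.sqrt #|G|%:R) + Num.sqrt Q * (Q ^+ 2 * Num.sqrt #|G|%:R))))).
  rewrite !ler_wpM2l ?mulr_ge0 ?exprn_ge0 ?sqrtr_ge0 //.
  by rewrite lerD // ler_wpM2l ?sqrtr_ge0 ?exprn_ge0.
rewrite le_eqVlt; apply/orP; left; apply/eqP.
transitivity (4%:R * Q ^+ 4 * Num.sqrt Q ^+ 2 * (t * Num.sqrt #|G|%:R)); first by ring.
by rewrite s2; ring.
Qed.

End Extension.

(** * Summation over level sets *)

Section Restriction.
Variables (R : realType) (F : finFieldType) (e : F -> R[i]).
Hypotheses (eP : additive_character e) (e_nontriv : nontrivial e).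
Hypothesis F2 : 2%N \notin [pchar F].
Local Notation V := 'rV[F]_5.
Local Notation X := ('rV[F]_5 * F)%type.
Local Notation q := (#|F|%:R : R[i]).
Local Notation Q := (#|F|%:R : R).
Implicit Types g h : X -> R[i].

(** Plancherel on F^6, discarding the frequencies off the paraboloid. *)
Lemma hat_norm_le g :
  \sum_xi normc (hat e g xi) ^+ 2 <= Q ^+ 6 * \sum_x normc (g x) ^+ 2.
Proof.
pose ft (w : X) := \sum_x g x * e (dotp w.1 x.1 + w.2 * x.2).
have -> : Q ^+ 6 * \sum_x normc (g x) ^+ 2 = \sum_w normc (ft w) ^+ 2.
  apply: (@complexI R); rewrite rmorphM rmorphXn rmorph_nat !rmorph_sum /=.
  under [RHS]eq_bigr do rewrite normc_sqr.
  have := @orthogonal_moment R X X (fun x w => e (dotp w.1 x.1 + w.2 * x.2)) g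
    (q ^+ 6) (fun x x' => (x.1 == x'.1) && (x.2 == x'.2)).
  move=> -> => [|x x']; last exact: phase_orthogonal.
  congr (_ * _); apply: eq_bigr => x _; rewrite normc_sqr.
  rewrite (eq_bigl (pred1 x)) ?big_pred1_eq // => x'.
  by rewrite -xpair_eqE -!surjective_pairing /= eq_sym.
have hatE xi : hat e g xi = ft (xi, dotp xi xi).
  by apply: eq_bigr => x _; rewrite /phase dotpC [X in _ + X]mulrC.
have -> : \sum_w normc (ft w) ^+ 2 = \sum_xi \sum_t normc (ft (xi, t)) ^+ 2.
  by rewrite pair_bigA; apply: eq_bigr => -[].
apply: ler_sum => xi _; rewrite hatE [leRHS](bigD1 (dotp xi xi)) //= lerDl.
by apply: sumr_ge0 => t _; rewrite exprn_ge0 ?normc_ge0.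
Qed.

Lemma hat_sum (I : finType) (G : I -> X -> R[i]) xi :
  hat e (fun x => \sum_i G i x) xi = \sum_i hat e (G i) xi.
Proof.
rewrite /hat; under eq_bigr do rewrite mulr_suml.
exact: exchange_big.
Qed.

Lemma pairing_sum (I : finType) (G : I -> X -> R[i]) :
  pairing e (fun x => \sum_i G i x) (fun x => \sum_i G i x) =
  \sum_i \sum_j pairing e (G i) (G j).
Proof.
rewrite /pairing; under eq_bigr do rewrite !hat_sum rmorph_sum big_distrlr /=.
under [X in _ - _ * X]eq_bigr do rewrite rmorph_sum big_distrlr /=.
rewrite exchange_big [X in _ - _ * X]exchange_big mulr_sumr -sumrB /=.
apply: eq_bigr => i _; rewrite exchange_big [X in _ - _ * X]exchange_big.
by rewrite mulr_sumr -sumrB.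
Qed.

Lemma pairing_scale (a b : R) g h :
  pairing e (fun x => real_complex R a * g x) (fun x => real_complex R b * h x) =
  real_complex R (a * b) * pairing e g h.
Proof.
have hatZ c k xi : hat e (fun x => real_complex R c * k x) xi = real_complex R c * hat e k xi.
  by rewrite /hat mulr_sumr; apply: eq_bigr => x _; rewrite mulrA.
have conjM c z : conjc (real_complex R c * z) = real_complex R c * conjc z.
  by rewrite rmorphM; congr (_ * _); apply: conjc_real.
rewrite /pairing mulrBr; congr (_ - _).
  rewrite mulr_sumr; apply: eq_bigr => xi _; rewrite !hatZ.
  by rewrite conjM rmorphM mulrACA.
rewrite mulrCA; congr (_ * _); rewrite mulr_sumr; apply: eq_bigr => x _.
by rewrite conjM rmorphM mulrACA.
Qed.

Lemma sum_normc_hat g : \sum_xi normc (hat e g xi) ^+ 2 <=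
  normc (pairing e g g) + Q ^+ 5 * \sum_x normc (g x) ^+ 2.
Proof.
have E : real_complex R (\sum_xi normc (hat e g xi) ^+ 2) =
    pairing e g g + real_complex R (Q ^+ 5 * \sum_x normc (g x) ^+ 2).
  rewrite rmorphM rmorphXn rmorph_nat !rmorph_sum /= /pairing.
  under eq_bigr do rewrite normc_sqr.
  by under [in X in _ = _ + X]eq_bigr do rewrite normc_sqr; rewrite subrK.
have ge0 : 0 <= \sum_xi normc (hat e g xi) ^+ 2.
  by apply: sumr_ge0 => xi _; rewrite exprn_ge0 ?normc_ge0.
rewrite -(ger0_norm ge0) -normc_real E; apply: le_trans (le_normcD _ _) _.
rewrite normc_real ger0_norm ?lerD // mulr_ge0 ?exprn_ge0 // sumr_ge0 // => x _.
by rewrite exprn_ge0 ?normc_ge0.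
Qed.

Local Notation half := (2%:R^-1 : R).

Lemma sum_half_dist (n j : nat) : \sum_(k < n) half ^+ ((k - j) + (j - k)) <= 4%:R.
Proof.
have half2 : half * 2%:R = 1 by rewrite mulVf ?pnatr_eq0.
have h0 m : 0 <= half ^+ m by rewrite exprn_ge0 ?invr_ge0.
(* The exponent is [|k - j|] by truncated subtraction. The induction on [n] carries the geometric
   tail, in one form up to [j] and in another beyond it. *)
suff [h1 h2] : ((n <= j)%N -> \sum_(k < n) half ^+ ((k - j) + (j - k)) <= half ^+ (j - n)) /\
   ((j < n)%N -> \sum_(k < n) half ^+ ((k - j) + (j - k)) <= 4%:R - 2%:R * half ^+ (n - j.+1)).
  have [/h2 h|/h1 h] := ltnP j n; first by apply: le_trans h _; rewrite lerBlDr lerDl mulr_ge0.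
  apply: le_trans h _; apply: le_trans (_ : 1 <= _); last by rewrite ler1n.
  by rewrite exprn_ile1 ?invr_ge0 // invf_le1 // ler1n.
elim: n => [|n [IH1 IH2]]; first by rewrite big_ord0; split.
rewrite big_ord_recr /=; split => [lt|].
  rewrite (eqP (ltnW lt)) add0n; apply: le_trans (lerD (IH1 (ltnW lt)) (lexx _)) _.
  by rewrite -[(j - n)%N]prednK ?subn_gt0 // -subnS exprS; have := h0 (j - n.+1)%N; lra.
rewrite ltnS leq_eqVlt => /orP[/eqP jn|lt].
  by move: IH1; rewrite jn !subnn => /(_ (leqnn _)); rewrite expr0; lra.
rewrite (eqP (ltnW lt)) addn0; apply: le_trans (lerD (IH2 lt) (lexx _)) _.
rewrite subSS -[(n - j)%N]prednK ?subn_gt0 // -subnS exprS.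
by have := h0 (n - j.+1)%N; lra.
Qed.

(** After normalization, [pairing_bound] puts the exponent 3/4 on the level with larger values. The
    powers of 2 then combine to [2^10 2^-(j - i) a^(3/4) b^(1/2)], and [a <= 1] gives
    [a^(3/4) b^(1/2) <= (a + b) / 2]. *)
Lemma pairing_level (E G : {set X}) (g h : X -> R[i]) (i j : nat) (a b : R) :
  (i <= j)%N -> (#|G| <= #|F| ^ 4)%N ->
  (forall x, normc (g x) <= half ^+ (5 * i) * (x \in E)%:R) ->
  (forall x, normc (h x) <= half ^+ (5 * j) * (x \in G)%:R) ->
  #|E|%:R * half ^+ (8 * i.+1) <= a -> #|G|%:R * half ^+ (8 * j.+1) <= b ->
  a <= 1 ->
  normc (pairing e g h) <= 2%:R ^+ 11 * Q ^+ 5 * (half ^+ (j - i) * (a + b)).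
Proof.
move=> ij G4 gE hG Ea Gb a1.
have half0 n : 0 < half ^+ n by rewrite exprn_gt0 ?invr_gt0.
pose sc (n : nat) (k : X -> R[i]) x := real_complex R ((half ^+ (5 * n))^-1) * k x.
have scP n k (S : {set X}) : (forall x, normc (k x) <= half ^+ (5 * n) * (x \in S)%:R) ->
    forall x, normc (sc n k x) <= (x \in S)%:R.
  move=> kS x; rewrite normcM normc_real ger0_norm ?invr_ge0 ?(ltW (half0 _)) //.
  by rewrite ler_pdivrMl.
have scK n k : (fun x => real_complex R (half ^+ (5 * n)) * sc n k x) =1 k.
  by move=> x; rewrite mulrA -rmorphM divff ?gt_eqF // rmorph1 mul1r.
have -> : pairing e g h = real_complex R (half ^+ (5 * i) * half ^+ (5 * j)) *
    pairing e (sc i g) (sc j h).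
  rewrite -pairing_scale /pairing /hat; congr (_ - _ * _); last first.
    by apply: eq_bigr => x _; rewrite !scK.
  by apply: eq_bigr => xi _; congr (_ * conjc _); apply: eq_bigr => x _; rewrite scK.
rewrite normcM normc_real ger0_norm ?mulr_ge0 ?(ltW (half0 _)) //.
apply: le_trans (ler_wpM2l _ (pairing_bound eP e_nontriv F2 (scP _ _ _ gE) (scP _ _ _ hG) G4)) _.
  by rewrite mulr_ge0 ?(ltW (half0 _)).
set t := Num.sqrt (Num.sqrt _); set m := Num.sqrt _.
rewrite (_ : half ^+ (5 * i) * half ^+ (5 * j) * (4%:R * Q ^+ 5 * (t * m)) =
  4%:R * Q ^+ 5 * (half ^+ (5 * i) * half ^+ (5 * j) * (t * m))); last by ring.
rewrite (_ : 2%:R ^+ 11 * _ * _ = 4%:R * Q ^+ 5 * (2%:R ^+ 9 * (half ^+ (j - i) * (a + b))));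
  last by ring.
rewrite ler_wpM2l ?mulr_ge0 ?exprn_ge0 //.
have a0 : 0 <= a by apply: le_trans Ea; rewrite mulr_ge0 ?(ltW (half0 _)).
have b0 : 0 <= b by apply: le_trans Gb; rewrite mulr_ge0 ?(ltW (half0 _)).
have t0 : 0 <= t by apply: sqrtr_ge0.
have m0 : 0 <= m by apply: sqrtr_ge0.
have t4 : t ^+ 4 = #|E|%:R ^+ 3 by rewrite (exprM _ 2 2) !sqr_sqrtr ?exprn_ge0 ?sqrtr_ge0.
have m2 : m ^+ 2 = #|G|%:R by rewrite sqr_sqrtr.
have [d jd] : exists d, j = (d + i)%N by exists (j - i)%N; rewrite subnK.
rewrite jd addnK in Gb *; move: (half0 i) (half0 d) Ea Gb.
have expr5 n : half ^+ (5 * n) = (half ^+ n) ^+ 5 by rewrite mulnC exprM.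
have expr8 n : half ^+ (8 * n.+1) = half ^+ 8 * (half ^+ n) ^+ 8.
  by rewrite mulnS exprD (mulnC 8 n) exprM.
rewrite !expr5 !expr8 !exprD; move: (half ^+ i) (half ^+ d) => u z u0 z0.
set A : R := #|E|%:R * _; set B : R := #|G|%:R * _ => Aa Bb.
have A0 : 0 <= A by rewrite !mulr_ge0 ?exprn_ge0 ?invr_ge0 ?(ltW u0) ?(ltW z0).
have B0 : 0 <= B by rewrite !mulr_ge0 ?exprn_ge0 ?invr_ge0 ?mulr_ge0 ?(ltW u0) ?(ltW z0).
rewrite -(ler_pXn2r (n := 4)) ?nnegrE //; first last.
- by rewrite !mulr_ge0 ?addr_ge0 ?exprn_ge0 ?(ltW u0) ?(ltW z0).
- by rewrite !mulr_ge0 ?exprn_ge0 ?mulr_ge0 ?(ltW u0) ?(ltW z0).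
have -> : (u ^+ 5 * (z * u) ^+ 5 * (t * m)) ^+ 4 = 2%:R ^+ 40 * z ^+ 4 * (A ^+ 3 * B ^+ 2).
  transitivity (u ^+ 40 * z ^+ 20 * (t ^+ 4 * (m ^+ 2) ^+ 2)); first by ring.
  by rewrite t4 m2 /A /B; field.
rewrite (_ : (_ * (z * _)) ^+ 4 = 2%:R ^+ 36 * z ^+ 4 * (a + b) ^+ 4); last by ring.
apply: (@le_trans _ _ (2%:R ^+ 40 * z ^+ 4 * (a ^+ 2 * b ^+ 2))).
  rewrite ler_wpM2l ?mulr_ge0 ?exprn_ge0 ?(ltW z0) // ler_pM ?exprn_ge0 //.
    apply: (@le_trans _ _ (a ^+ 3)); first by rewrite lerXn2r.
    by rewrite ler_wiXn2l.
  by rewrite lerXn2r.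
rewrite (_ : 2%:R ^+ 40 * z ^+ 4 * (a ^+ 2 * b ^+ 2) =
  2%:R ^+ 36 * z ^+ 4 * (4%:R * a * b) ^+ 2); last by ring.
rewrite ler_wpM2l ?mulr_ge0 ?exprn_ge0 ?(ltW z0) // (exprM _ 2 2).
rewrite lerXn2r ?nnegrE ?mulr_ge0 ?sqr_ge0 ?addr_ge0 //.
by have := sqr_ge0 (a - b); nra.
Qed.

(* [w] plays the role of [|g|^(8/5)]. *)
Lemma hat_bound g (w : X -> R) : (forall x, 0 <= w x) -> \sum_x w x <= 1 ->
  (forall x, normc (g x) ^+ 8 = w x ^+ 5) ->
  \sum_xi normc (hat e g xi) ^+ 2 <= 2%:R ^+ 16 * Q ^+ 5.
Proof.
move=> w0 w1 gw.
have Q0 : 0 < Q by rewrite ltr0n card_field_gt0.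
have half0 n : 0 < half ^+ n by rewrite exprn_gt0 ?invr_gt0.
have wle1 x : w x <= 1.
  by apply: le_trans w1; rewrite (bigD1 x) //= lerDl sumr_ge0.
(* The levels have ratio [2^-8] for [w], hence [2^-5] for [|g|]. *)
pose large x := (Q ^+ 4)^-1 < w x.
pose E (j : nat) := [set x | [&& half ^+ (8 * j.+1) < w x, w x <= half ^+ (8 * j) & large x]].
pose gj (j : nat) x := if x \in E j then g x else 0.
pose gs x := \sum_(j < #|F|.+1) gj j x.
pose gl x := if large x then 0 else g x.
have half_le m n : (m <= n)%N -> half ^+ n <= half ^+ m.
  by apply: ler_wiXn2l; rewrite ?invr_ge0 // invf_le1 // ler1n.
have disjoint (i j : nat) (x : X) : x \in E i -> x \in E j -> (i <= j)%N.
  rewrite !inE => /and3P[_ wi _] /and3P[wj _ _]; rewrite leqNgt; apply/negP => ji.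
  by have := lt_le_trans wj wi; rewrite ltNge half_le // leq_mul2l.
(* Since [2^q >= q], the levels up to [#|F|] reach the threshold; their number does not enter the
   final constant. *)
have last_level : half ^+ (8 * #|F|.+1) <= (Q ^+ 4)^-1.
  rewrite exprVn lef_pV2 ?posrE ?exprn_gt0 // -!natrX ler_nat.
  apply: leq_trans (_ : (2 ^ #|F|) ^ 4 <= _)%N; first by rewrite leq_exp2r // ltnW // ltn_expl.
  by rewrite -expnM leq_exp2l // mulnC leq_mul.
have cover (x : X) : large x -> exists j : 'I_#|F|.+1, x \in E j.
  move=> lx; have ex : exists n, half ^+ (8 * n.+1) < w x.
    by exists #|F|; apply: le_lt_trans lx.
  case: (ex_minnP ex) => n nw min_n; have nF : (n < #|F|.+1)%N.
    by rewrite ltnS min_n //; apply: le_lt_trans lx.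
  exists (Ordinal nF); rewrite inE nw lx andbT /=.
  case: n nw min_n {nF} => [|n] nw min_n; first by rewrite muln0 expr0.
  by rewrite leNgt; apply/negP => /min_n; rewrite ltnn.
have level_sum (U : nmodType) (u : U) (x : X) :
    \sum_(j < #|F|.+1) (if x \in E j then u else 0) = if large x then u else 0.
  have [lx|lx] := boolP (large x); last first.
    by apply: big1 => j _; rewrite inE (negPf lx) !andbF.
  have [j xj] := cover x lx; rewrite (bigD1 j) //= xj big1 ?addr0 // => i ij.
  case: ifP => // xi; case/eqP: ij; apply/val_inj/eqP.
  by rewrite eqn_leq !(disjoint _ _ x).
have gsE x : gs x = if large x then g x else 0 by apply: level_sum.
have gE x : g x = gs x + gl x.
  by rewrite gsE /gl; case: ifP; rewrite ?addr0 ?add0r.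
have gs_le x : normc (gs x) ^+ 2 <= w x.
  rewrite gsE; case: ifP => _; last by rewrite normc0 expr0n.
  rewrite -(ler_pXn2r (n := 4)) ?nnegrE ?exprn_ge0 ?normc_ge0 // -exprM gw.
  by rewrite exprSr ler_piMr ?exprn_ge0.
(* Below the threshold [|g|^8 = w^5 <= w^4 / q^4]. The factor [1 / q] compensates for the loss in
   [hat_norm_le]. *)
have gl_le x : normc (gl x) ^+ 2 <= w x / Q.
  have wQ0 : 0 <= w x / Q by rewrite divr_ge0.
  rewrite /gl; case: ifPn => lx; first by rewrite normc0 expr0n.
  rewrite -(ler_pXn2r (n := 4)) ?nnegrE ?exprn_ge0 ?normc_ge0 // -exprM gw.
  by rewrite exprSr exprMn exprVn ler_wpM2l ?exprn_ge0 // leNgt.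
pose a (j : nat) : R := \sum_(x in E j) w x.
have suma : \sum_(j < #|F|.+1) a j <= 1.
  apply: le_trans w1; rewrite /a; under eq_bigr do rewrite big_mkcond.
  rewrite exchange_big; apply: ler_sum => x _.
  by rewrite level_sum; case: ifP.
have a0 j : 0 <= a j by apply: sumr_ge0.
have a1 (j : 'I_#|F|.+1) : a j <= 1.
  by apply: le_trans suma; rewrite (bigD1 j) //= lerDl sumr_ge0.
have cardE (j : 'I_#|F|.+1) : (#|E j| <= #|F| ^ 4)%N.
  rewrite -(ler_nat R) natrX -[leRHS]mul1r -ler_pdivrMr ?exprn_gt0 //.
  apply: le_trans (a1 j); rewrite mulr_natl -sumr_const.
  by apply: ler_sum => x; rewrite inE => /and3P[_ _ /ltW].
have Ea j : #|E j|%:R * half ^+ (8 * j.+1) <= a j.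
  rewrite mulr_natl -sumr_const.
  by apply: ler_sum => x; rewrite inE => /and3P[/ltW].
have gj_le j x : normc (gj j x) <= half ^+ (5 * j) * (x \in E j)%:R.
  rewrite /gj; case: ifPn => [|_]; last by rewrite normc0 mulr0.
  rewrite inE mulr1 => /and3P[_ wj _].
  rewrite -(ler_pXn2r (n := 8)) ?nnegrE ?normc_ge0 ?(ltW (half0 _)) // gw.
  have -> : half ^+ (5 * j) ^+ 8 = half ^+ (8 * j) ^+ 5.
    by rewrite -!exprM (mulnC 5) (mulnC 8) -!mulnA.
  by rewrite lerXn2r ?nnegrE ?(ltW (half0 _)).
have pair_le (i j : 'I_#|F|.+1) : normc (pairing e (gj i) (gj j)) <=
    2%:R ^+ 11 * Q ^+ 5 * (half ^+ ((j - i) + (i - j)) * (a i + a j)).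
  have main (k l : 'I_#|F|.+1) : (k <= l)%N -> normc (pairing e (gj k) (gj l)) <=
      2%:R ^+ 11 * Q ^+ 5 * (half ^+ ((l - k) + (k - l)) * (a k + a l)).
    move=> kl; rewrite (eqP kl) addn0.
    exact: pairing_level kl (cardE l) (gj_le k) (gj_le l) (Ea k) (Ea l) (a1 k).
  have [/main//|/ltnW/main] := leqP i j.
  (* For [j < i] conjugate symmetry exchanges the arguments, which supplies the second of the two
     bounds. *)
  by rewrite pairing_conj normc_conj addnC (addrC (a j)).
have hat_gl : \sum_xi normc (hat e gl xi) ^+ 2 <= Q ^+ 5.
  apply: le_trans (hat_norm_le _) _.
  apply: (@le_trans _ _ (Q ^+ 6 * (\sum_x w x / Q))).
    by rewrite ler_wpM2l ?exprn_ge0 ?(ltW Q0) // ler_sum.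
  rewrite -mulr_suml mulrCA (_ : Q ^+ 6 / Q = Q ^+ 5); last by field; rewrite gt_eqF.
  by rewrite ler_piMl ?exprn_ge0 ?(ltW Q0).
(* The double sum costs [2^11 (4 + 4) = 2^14]; the extra 1 is the diagonal term. *)
have hat_gs : \sum_xi normc (hat e gs xi) ^+ 2 <= (2%:R ^+ 14 + 1) * Q ^+ 5.
  apply: le_trans (sum_normc_hat _) _; rewrite mulrDl mul1r lerD //; last first.
    rewrite ler_piMr ?exprn_ge0 ?(ltW Q0) // (le_trans _ w1) // ler_sum // => x _.
  rewrite pairing_sum; apply: le_trans (normc_sum _ _) _.
  apply: (@le_trans _ _ (\sum_(i < #|F|.+1) \sum_(j < #|F|.+1)
    2%:R ^+ 11 * Q ^+ 5 * (half ^+ ((j - i) + (i - j)) * (a i + a j)))).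
    by apply: ler_sum => i _; apply: le_trans (normc_sum _ _) _; apply: ler_sum.
  under eq_bigr do rewrite -mulr_sumr.
  rewrite -mulr_sumr (_ : 2%:R ^+ 14 * _ = 2%:R ^+ 11 * Q ^+ 5 * 8%:R); last by ring.
  rewrite ler_wpM2l ?mulr_ge0 ?exprn_ge0 ?(ltW Q0) //.
  under eq_bigr do (under eq_bigr do rewrite mulrDr; rewrite big_split /=).
  rewrite big_split /= [X in _ + X]exchange_big /=.
  have row_le i : \sum_(j < #|F|.+1) half ^+ ((j - i) + (i - j)) * a i <= 4%:R * a i.
    by rewrite -mulr_suml ler_wpM2r ?sum_half_dist ?sumr_ge0.
  rewrite (_ : 8%:R = 4%:R * 1 + 4%:R * 1); last by ring.
  apply: lerD; apply: le_trans (_ : \sum_(i < #|F|.+1) 4%:R * a i <= _);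
    rewrite -?mulr_sumr ?ler_wpM2l // mulr_sumr; apply: ler_sum => i _; last first.
    by under eq_bigr do rewrite addnC; apply: row_le.
  exact: row_le.
apply: (@le_trans _ _ (\sum_xi 2%:R * (normc (hat e gs xi) ^+ 2 + normc (hat e gl xi) ^+ 2))).
  apply: ler_sum => xi _.
  have -> : hat e g xi = hat e gs xi + hat e gl xi.
    by rewrite /hat -big_split; apply: eq_bigr => x _; rewrite gE mulrDl.
  have h1 := le_normcD (hat e gs xi) (hat e gl xi).
  apply: (@le_trans _ _ ((normc (hat e gs xi) + normc (hat e gl xi)) ^+ 2)).
    by rewrite lerXn2r ?nnegrE ?addr_ge0 ?normc_ge0.
  rewrite -subr_ge0 (_ : _ - _ = (normc (hat e gs xi) - normc (hat e gl xi)) ^+ 2); last by ring.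
  exact: sqr_ge0.
rewrite -mulr_sumr big_split /=.
apply: le_trans (ler_wpM2l _ (lerD hat_gs hat_gl)) _ => //.
have := exprn_ge0 5 (ltW Q0); lra.
Qed.

End Restriction.

(** * From restriction to extension by duality *)

Section Duality.
Variables (R : realType) (F : finFieldType) (e : F -> R[i]).
Hypotheses (eP : additive_character e) (e_nontriv : nontrivial e).
Hypothesis F2 : 2%N \notin [pchar F].
Local Notation V := 'rV[F]_5.
Local Notation X := ('rV[F]_5 * F)%type.
Local Notation Q := (#|F|%:R : R).

Definition embed (p : X) : 'rV[F]_(5 + 1) := row_mx p.1 p.2%:M.

Lemma embed_bij : bijective embed.
Proof.
exists (fun x => (lsubmx x, rsubmx x 0 0)) => [[y t]|x]; rewrite /embed /=.
  by rewrite row_mxKl row_mxKr mxE eqxx mulr1n.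
by rewrite -mx11_scalar hsubmxK.
Qed.

Lemma dotp_embed p p' : dotp (embed p) (embed p') = dotp p.1 p'.1 + p.2 * p'.2.
Proof.
rewrite /dotp big_split_ord big_ord1; congr (_ + _).
  by apply: eq_bigr => i _; rewrite !row_mxEl.
by rewrite !row_mxEr !mxE eqxx !mulr1n.
Qed.

Lemma embed_paraboloid xi : embed (xi, dotp xi xi) \in paraboloid F 5.
Proof. exact: imset_f. Qed.

Definition lift_point xi : on_paraboloid F 5 :=
  exist (fun x => x \in paraboloid F 5) _ (embed_paraboloid xi).

Lemma lift_point_bij : bijective lift_point.
Proof.
apply: inj_card_bij => [x y /(congr1 val) /= /(bij_inj embed_bij) []//|].
rewrite card_sig; apply: leq_imset_card.
Qed.

Lemma extension_embed (f : on_paraboloid F 5 -> R[i]) p :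
  extension e f (embed p) = real_complex R (sigma_mass R F 5) *
    \sum_xi f (lift_point xi) * phase e p xi.
Proof.
rewrite /extension (reindex lift_point) /=; last exact/onW_bij/lift_point_bij.
by congr (_ * _); apply: eq_bigr => xi _; rewrite dotp_embed.
Qed.

(** The extension is tested against the extremizer [g] of Hölder's inequality, which recovers its
    norm [S^(3/8)]. Moving the transform onto [g] and applying Cauchy-Schwarz reduces to
    [hat_bound]; the square root of its [2^16] is the constant. *)
Lemma extension_bound (f : on_paraboloid F 5 -> R[i]) :
  Lp_norm 1 (8%:R / 3%:R) (extension e f) <=
    2%:R ^+ 8 * Lp_norm (sigma_mass R F 5) 2%:R f.
Proof.
have Q0 : 0 < Q by rewrite ltr0n card_field_gt0.
have sig0 : 0 <= sigma_mass R F 5 by rewrite invr_ge0 exprn_ge0 ?ltW.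
pose A p := extension e f (embed p).
pose S : R := \sum_p normc (A p) `^ (8%:R / 3%:R).
pose T : R := \sum_xi normc (f (lift_point xi)) ^+ 2.
have T0 : 0 <= T by apply: sumr_ge0 => xi _; rewrite exprn_ge0 ?normc_ge0.
have -> : Lp_norm (sigma_mass R F 5) 2%:R f = Num.sqrt (sigma_mass R F 5 * T).
  rewrite /Lp_norm powR12_sqrt ?mulr_ge0 // ?sumr_ge0 // => [|x _]; last exact: powR_ge0.
  congr (Num.sqrt (_ * _)); rewrite (reindex lift_point) /=; last exact/onW_bij/lift_point_bij.
  by apply: eq_bigr => xi _; rewrite powR_mulrn ?normc_ge0.
have -> : Lp_norm 1 (8%:R / 3%:R) (extension e f) = S `^ (3%:R / 8%:R).
  rewrite /Lp_norm mul1r invf_div (reindex embed) //; exact/onW_bij/embed_bij.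
have S0 : 0 <= S by apply: sumr_ge0 => p _; apply: powR_ge0.
have [->|Sn0] := eqVneq S 0.
  by rewrite powR0 ?mulf_neq0 ?invr_neq0 ?pnatr_eq0 // mulr_ge0 ?exprn_ge0 ?sqrtr_ge0.
pose w p := normc (A p) `^ (8%:R / 3%:R) / S.
(* [|g| = |A|^(5/3) / S^(5/8)], so [|g|^(8/5) = w] has total mass 1. Division by [S] is why [S = 0]
   was treated apart. *)
pose g p := real_complex R (normc (A p) `^ (2%:R / 3%:R) / S `^ (5%:R / 8%:R)) * conjc (A p).
have pow_split (a : R) : 0 <= a -> a `^ (2%:R / 3%:R) * a ^+ 2 = a `^ (8%:R / 3%:R).
  move=> a0; rewrite -powR_mulrn // -powRD; last first.
    by apply/implyP => h; exfalso; move: h; apply/negP; lra.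
  by congr (_ `^ _); lra.
have gw p : normc (g p) ^+ 8 = w p ^+ 5.
  rewrite normcM normc_conj normc_real ger0_norm ?divr_ge0 ?powR_ge0 //.
  have a0 := normc_ge0 (A p); rewrite /w -pow_split //.
  have b3 : normc (A p) `^ (2%:R / 3%:R) ^+ 3 = normc (A p) ^+ 2.
    rewrite -(powR_mulrn 3) ?powR_ge0 // -powRrM -powR_mulrn //.
    by congr (_ `^ _); lra.
  have s8 : S `^ (5%:R / 8%:R) ^+ 8 = S ^+ 5.
    rewrite -(powR_mulrn 8) ?powR_ge0 // -powRrM -powR_mulrn //.
    by congr (_ `^ _); lra.
  move: b3 s8; set b := _ `^ (2%:R / 3%:R); set s := S `^ _ => b3 s8.
  transitivity (b ^+ 5 * b ^+ 3 * normc (A p) ^+ 8 * s^-1 ^+ 8); first by ring.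
  by rewrite b3 exprVn s8 -exprVn; ring.
have w0 p : 0 <= w p by rewrite divr_ge0 ?powR_ge0.
have w1 : \sum_p w p <= 1 by rewrite -mulr_suml divff.
have hat_le := hat_bound eP e_nontriv F2 w0 w1 gw.
have dual : real_complex R (S `^ (3%:R / 8%:R)) = real_complex R (sigma_mass R F 5) *
    \sum_xi f (lift_point xi) * hat e g xi.
  transitivity (\sum_p g p * A p).
    have -> : S `^ (3%:R / 8%:R) = S / S `^ (5%:R / 8%:R).
      apply: (canRL (mulfK _)); first by rewrite powR_eq0 negb_and Sn0.
      rewrite -powRD ?Sn0 ?implybT // -[RHS]powRr1 //; congr (_ `^ _); lra.
    rewrite mulr_suml rmorph_sum; apply: eq_bigr => p _.
    rewrite -pow_split ?normc_ge0 // /g -[RHS]mulrA (mulrC (conjc _)) -normc_sqr -rmorphM.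
    by congr (real_complex R _); ring.
  rewrite mulr_sumr; under [RHS]eq_bigr do rewrite !mulr_sumr.
  rewrite exchange_big; apply: eq_bigr => p _.
  rewrite /A extension_embed !mulr_sumr; apply: eq_bigr => xi _.
  by rewrite mulrCA; congr (_ * _); rewrite mulrCA.
have S30 : 0 <= S `^ (3%:R / 8%:R) by apply: powR_ge0.
rewrite -(ler_pXn2r (n := 2)) ?nnegrE ?mulr_ge0 ?exprn_ge0 ?sqrtr_ge0 //.
have -> : S `^ (3%:R / 8%:R) = normc (real_complex R (S `^ (3%:R / 8%:R))).
  by rewrite normc_real ger0_norm.
rewrite dual normcM normc_real ger0_norm // !exprMn sqr_sqrtr ?mulr_ge0 //.
apply: (@le_trans _ _ (sigma_mass R F 5 ^+ 2 * (T * (2%:R ^+ 16 * Q ^+ 5)))); last first.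
  rewrite le_eqVlt; apply/orP; left; apply/eqP.
  by rewrite /sigma_mass; field; rewrite gt_eqF.
rewrite ler_wpM2l ?exprn_ge0 //.
apply: (@le_trans _ _ ((\sum_xi normc (f (lift_point xi)) * normc (hat e g xi)) ^+ 2)).
  have ge0 : 0 <= \sum_xi normc (f (lift_point xi)) * normc (hat e g xi).
    by apply: sumr_ge0 => xi _; rewrite mulr_ge0 ?normc_ge0.
  rewrite lerXn2r ?nnegrE ?normc_ge0 //.
  by apply: le_trans (normc_sum _ _) _; apply: ler_sum => xi _; rewrite normcM.
by apply: le_trans (cauchy_schwarz _ _ _) _; rewrite ler_wpM2l.
Qed.

End Duality.

Theorem theorem1p2 (R : realType) :
  exists C : R,
    forall (F : finFieldType) (e : F -> R[i]),
      2%N \notin [pchar F] -> additive_character e -> nontrivial e ->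
      forall f : on_paraboloid F 5 -> R[i],
        Lp_norm 1 (8%:R / 3%:R) (extension e f)
          <= C * Lp_norm (sigma_mass R F 5) 2%:R f.
Proof.
by exists (2%:R ^+ 8) => F e F2 eP e_nontriv f; apply: extension_bound.
Qed.
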